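(* For every fixed positive integer $k$, the $k$-DMLOB problem restricted to digraphs in $\mathcal{L}$ is solvable in linear time: there is an algorithm which, given a digraph $D\in\mathcal{L}$, decides whether $\ell_s(D)\ge k$ in time $O(|V(D)|+|A(D)|)$, where the constant hidden in the $O$-notation depends only on $k$.
   Context: Digraphs are finite, without loops or parallel arcs; $V(D)$ and $A(D)$ denote the vertex and arc sets. An out-tree of a digraph $D$ is a subdigraph $T$ that is an oriented tree with exactly one vertex of in-degree zero (the root); its leaves are its vertices of out-degree zero. An out-branching of $D$ is an out-tree $T$ with $V(T)=V(D)$. $\ell(D)$ denotes the maximum number of leaves of an out-tree of $D$, and $\ell_s(D)$ the maximum number of leaves of an out-branching of $D$, with $\ell_s(D)=0$ if $D$ has no out-branching. $\mathcal{L}$ is the family of digraphs $D$ for which either $\ell_s(D)=0$ or $\ell_s(D)=\ell(D)$. The $k$-DMLOB problem: given a digraph $D$ and a positive integer parameter $k$, decide whether $\ell_s(D)\ge k$. *)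

(* Defs.v *)
From mathcomp Require Import all_boot.

Set Implicit Arguments.
Unset Strict Implicit.
Unset Printing Implicit Defensive.

Record digraph (V : finType) := Digraph {
  arcs :> {set V * V};
  loopless : forall v : V, (v, v) \notin arcs }.

Section OutTrees.
Variable V : finType.
Implicit Types (F : {set V * V}) (T : {set V} * {set V * V}) (D : digraph V).

Definition indeg F (v : V) := #|[set u | (u, v) \in F]|.
Definition outdeg F (v : V) := #|[set u | (v, u) \in F]|.

Definition underlying F : rel V := fun u v => ((u, v) \in F) || ((v, u) \in F).

(* The length of a cycle without repeated vertex is at most #|V|, which is why
   a bounded quantifier suffices; see acyclicP. *)
Definition acyclic (e : rel V) : bool :=
  [forall l : 'I_#|V|.+1, [forall s : l.-tuple V, ucycleb e s ==> (size s <= 2)]].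

Lemma acyclicP (e : rel V) :
  reflect (forall s : seq V, ucycle e s -> size s <= 2) (acyclic e).
Proof.
apply: (iffP forallP) => [H s es|H l].
  have lt_s : size s < #|V|.+1.
    by case/andP: es => _ us; rewrite ltnS -(card_uniqP us) max_card.
  by move/forallP: (H (Ordinal lt_s)) => /(_ (in_tuple s)) /implyP; apply.
by apply/forallP => s; apply/implyP; apply: H.
Qed.

Definition subdigraph D T : bool :=
  (T.2 \subset D) && [forall a in T.2, (a.1 \in T.1) && (a.2 \in T.1)].

(* An orientation of a tree: at most one of the two arcs between any two
   vertices, and an underlying graph that is connected and acyclic. *)
Definition oriented_tree T : bool :=
  [&& T.1 != set0,
      [forall u, forall v, ~~ (((u, v) \in T.2) && ((v, u) \in T.2))],
      [forall u in T.1, forall v in T.1, connect (underlying T.2) u v]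
    & acyclic (underlying T.2)].

Definition out_tree D T : bool :=
  [&& subdigraph D T, oriented_tree T
    & #|[set v in T.1 | indeg T.2 v == 0]| == 1].

Definition leaves T : {set V} := [set v in T.1 | outdeg T.2 v == 0].

Definition out_branching D T : bool := out_tree D T && (T.1 == [set: V]).

(* The maximum over an empty range is 0. *)
Definition ell D : nat := \max_(T | out_tree D T) #|leaves T|.
Definition ell_s D : nat := \max_(T | out_branching D T) #|leaves T|.

Definition calL D : Prop := ell_s D = 0 \/ ell_s D = ell D.

End OutTrees.

(* Unit-cost random access machine: a program uses finitely many registers and
   an unbounded memory, both holding natural numbers; subtraction is truncated.
   Multiplication is not primitive. *)
Inductive instr :=
  | Const (r c : nat)    (* R[r] := c *)
  | Add (r s t : nat)    (* R[r] := R[s] + R[t] *)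
  | Sub (r s t : nat)    (* R[r] := R[s] - R[t] *)
  | Read (r s : nat)     (* R[r] := M[R[s]] *)
  | Write (r s : nat)    (* M[R[r]] := R[s] *)
  | Jump (l : nat)       (* goto l *)
  | JumpZ (r l : nat).   (* if R[r] = 0 goto l *)

Definition program := seq instr.

Record config := Config { pc : nat; reg : nat -> nat; mem : nat -> nat }.

Definition upd (f : nat -> nat) (i x : nat) : nat -> nat :=
  fun j => if j == i then x else f j.

Definition exec (i : instr) (C : config) : config :=
  let: Config p R M := C in
  match i with
  | Const r c => Config p.+1 (upd R r c) M
  | Add r s t => Config p.+1 (upd R r (R s + R t)) M
  | Sub r s t => Config p.+1 (upd R r (R s - R t)) M
  | Read r s => Config p.+1 (upd R r (M (R s))) M
  | Write r s => Config p.+1 R (upd M (R r) (R s))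
  | Jump l => Config l R M
  | JumpZ r l => Config (if R r == 0 then l else p.+1) R M
  end.

Definition halted (P : program) (C : config) : bool := size P <= pc C.

Definition step (P : program) (C : config) : config :=
  if onth P (pc C) is Some i then exec i C else C.

Definition init (w : seq nat) : config := Config 0 (fun=> 0) (nth 0 w).

Definition run (P : program) (w : seq nat) (t : nat) : config :=
  iter t (step P) (init w).

(* All machine words, hence all addresses used, are at most B. *)
Definition word_bounded (B : nat) (C : config) : Prop :=
  forall i, reg C i <= B /\ mem C i <= B.

(* On input w, P halts after at most T steps with answer b, which is read off
   register 0, and only ever holds words that are at most B. *)
Definition answers_within (P : program) (w : seq nat) (T B : nat) (b : bool) :
    Prop :=
  exists t, [/\ t <= T, halted P (run P w t),
                (reg (run P w t) 0 != 0) = b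
              & forall i, i <= t -> word_bounded B (run P w i)].

(* Input format: the number of vertices, the number of arcs, and then the tail
   and the head of each arc, in the order of the list s. *)
Definition encode (n : nat) (s : seq ('I_n * 'I_n)) : seq nat :=
  [:: n, size s & flatten [seq [:: val a.1; val a.2] | a <- s]].

(* Main.v *)
Require Import Defs.
From mathcomp Require Import all_boot zify.
(* Imported again because [Defs.mem] and [Defs.Sub] are shadowed by MathComp. *)
Import Defs.

Set Implicit Arguments.
Unset Strict Implicit.
Unset Printing Implicit Defensive.

(** If D has a vertex from which all vertices can be reached, then
    ell_s(D) = ell(D), and it remains to decide whether D has an out-tree with k
    leaves. Number the vertices in the order in which a search started at such a
    vertex finds them. A prefix of this order is spanned by an out-tree, so if k
    arc heads lie outside, they are the leaves of an out-tree. Otherwise the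
    corresponding suffix is covered by fewer than k out-trees, rooted at those
    heads, and each of them has fewer than k arc heads in the prefix, or again
    there are k leaves. Hence either the answer is yes, or fewer than k + k^2
    vertices are heads of arcs across any given cut of the order. In the latter
    case a sweep along the order, which keeps only those vertices in a bounded
    number of slots, can decide with a finite automaton whether there is
    an out-tree with k leaves. If the sweep runs out of slots, the answer
    is yes.

    The root is found by repeated searches: if there is a root, the start of the
    last search that is needed to visit all vertices is one.

    The program is written in a small language of loop-free blocks, iterated by
    a single loop. As its only arithmetic operation is the successor, words are
    linear in the input and the running time. *)

(** A sweep could decide reachability by remembering how the slots are connected. Here it is
    dualised: a vertex is reachable if it lies in every set that contains the root and is closed
    under the relevant arcs. Every arc then imposes a check on its two ends alone, at the price of a
    second powerset construction.

    A slot can be freed only when it is known that no later arc concerns its vertex. The second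
    search, whose queue is the order of the sweep, therefore records for each vertex the last
    position that concerns it.

    Addition on the machine can double a word at every step, so a linear running time alone would
    leave room for exponentially large words. Through the source language, growth is counted per
    pass, where it is additive. *)

Inductive stm :=
  | Skip
  | Cst (x c : nat)
  | Mov (x y : nat)
  | Inc (x y : nat)
  | Ld (a : 'I_8) (x y : nat)
  | St (a : 'I_8) (x y : nat)
  | Inp (x y : nat)
  | Seq (b1 b2 : stm)
  | IfLt (x y : nat) (b1 b2 : stm)
  | IfLtc (x c : nat) (b1 b2 : stm).

Record state := State { rg : nat -> nat; ar : nat -> nat -> nat }.

Definition upd2 (A : nat -> nat -> nat) (a i x : nat) : nat -> nat -> nat :=
  fun b j => if (b == a) && (j == i) then x else A b j.

Fixpoint ex (w : nat -> nat) (b : stm) (s : state) : state :=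
  match b with
  | Skip => s
  | Cst x c => State (upd (rg s) x c) (ar s)
  | Mov x y => State (upd (rg s) x (rg s y)) (ar s)
  | Inc x y => State (upd (rg s) x (rg s y).+1) (ar s)
  | Ld a x y => State (upd (rg s) x (ar s a (rg s y))) (ar s)
  | St a x y => State (rg s) (upd2 (ar s) a (rg s x) (rg s y))
  | Inp x y => State (upd (rg s) x (w (rg s y))) (ar s)
  | Seq b1 b2 => ex w b2 (ex w b1 s)
  | IfLt x y b1 b2 => if rg s x < rg s y then ex w b1 s else ex w b2 s
  | IfLtc x c b1 b2 => if rg s x < c then ex w b1 s else ex w b2 s
  end.

Definition state0 := State (fun=> 0) (fun _ _ => 0).

(** * Compilation to the random access machine *)

(* Register 0 receives the answer, 1 and 2 are scratch registers that are zero
   between source instructions, 3 holds the length [base] of the input, and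
   source register x lives in register x + 4. Entry i of array a lives at
   address base + 8 i + a. *)
Definition addr_code (a y : nat) : seq instr :=
  [:: Add 1 y.+4 2; Add 1 1 1; Add 1 1 1; Add 1 1 1; Add 1 1 3; Const 2 a;
      Add 1 1 2].

(** Jump targets are absolute, hence the position [l]. Only [c1] is preceded by [Const 1 0]: when
    the jump to [c2] is taken, register 1 is zero already. *)
Definition if_code (l : nat) (tst c1 c2 : seq instr) : seq instr :=
  tst ++ JumpZ 1 (l + size tst + size c1 + 3) :: Const 1 0 :: c1
      ++ Jump (l + size tst + size c1 + 3 + size c2) :: c2.

Fixpoint comp (l : nat) (b : stm) : seq instr :=
  match b with
  | Skip => [::]
  | Cst x c => [:: Const x.+4 c]
  | Mov x y => [:: Add x.+4 y.+4 1]
  | Inc x y => [:: Const 1 1; Add x.+4 y.+4 1; Const 1 0]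
  | Ld a x y => addr_code a y ++ [:: Read x.+4 1; Const 1 0; Const 2 0]
  | St a x y => addr_code a x ++ [:: Write 1 y.+4; Const 1 0; Const 2 0]
  | Inp x y => if_code l [:: Sub 1 3 y.+4] [:: Read x.+4 y.+4]
                 [:: Const x.+4 0]
  | Seq b1 b2 => let c1 := comp l b1 in c1 ++ comp (l + size c1) b2
  | IfLt x y b1 b2 =>
    let c1 := comp l.+3 b1 in
    if_code l [:: Sub 1 y.+4 x.+4] c1 (comp (l + size c1 + 4) b2)
  | IfLtc x c b1 b2 =>
    let c1 := comp l.+4 b1 in
    if_code l [:: Const 1 c; Sub 1 1 x.+4] c1 (comp (l + size c1 + 5) b2)
  end.

Definition code_at (P : program) l (c : seq instr) :=
  forall i, i < size c -> onth P (l + i) = onth c i.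

Lemma code_at_cat P l c1 c2 :
  code_at P l (c1 ++ c2) -> code_at P l c1 /\ code_at P (l + size c1) c2.
Proof.
move=> H; split=> i hi.
  by rewrite H ?size_cat ?ltn_addr // onth_cat hi.
rewrite -addnA H ?size_cat ?ltn_add2l // onth_cat ifN; last by lia.
by rewrite addKn.
Qed.

Lemma code_at_cons P l i c :
  code_at P l (i :: c) -> onth P l = Some i /\ code_at P l.+1 c.
Proof.
move=> H; split; first by have := H 0 isT; rewrite addn0.
by move=> j hj; have := H j.+1 hj; rewrite addnS.
Qed.

Lemma step_some P p R M i :
  onth P p = Some i -> step P (Config p R M) = exec i (Config p R M).
Proof. by rewrite /step /= => ->. Qed.

Definition straight i :=
  match i with Jump _ | JumpZ _ _ => false | _ => true end.

Lemma run_straight P c C :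
  all straight c -> code_at P (pc C) c ->
  iter (size c) (step P) C = foldl (fun C i => exec i C) C c
  /\ pc (iter (size c) (step P) C) = pc C + size c.
Proof.
elim: c C => [|i c IH] C /=; first by rewrite addn0.
move=> /andP[si sc] /code_at_cons[hi hc].
rewrite -iterS iterSr /step hi addnS -addSn.
have hpc : pc (exec i C) = (pc C).+1 by case: C i si {hi hc} => p R M [].
by have [-> ->] := IH (exec i C) sc (eq_rect_r (code_at P ^~ c) hc hpc); rewrite hpc.
Qed.

Section Simulation.
Variables (w : nat -> nat) (base : nat).
Hypothesis w_base : forall i, base <= i -> w i = 0.

Definition repr (s : state) (C : config) : Prop :=
  [/\ forall x, reg C x.+4 = rg s x,
      [/\ reg C 0 = 0, reg C 1 = 0, reg C 2 = 0 & reg C 3 = base],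
      forall j, j < base -> mem C j = w j
    & forall (a : 'I_8) i, mem C (base + (8 * i + a)) = ar s a i].

(** Blocks only jump forward, hence at most [size c] steps. [pre] carries the outcome of a test into
    its branch. *)
Definition simulates (pre : pred state) (P : program) l (c : seq instr) f :=
  forall s C, pre s -> pc C = l -> repr s C ->
  exists t, [/\ t <= size c, pc (iter t (step P) C) = l + size c
    & repr (f s) (iter t (step P) C)].

Lemma addr_inj (a b : 'I_8) i j :
  (base + (8 * j + b) == base + (8 * i + a)) = (b == a :> nat) && (j == i).
Proof.
rewrite eqn_add2l; apply/eqP/andP=> [|[/eqP-> /eqP->]] //.
case: a b => [a ha] [b hb] /= h; split; apply/eqP; lia.
Qed.

Lemma simulates_straight (pre : pred state) P l c f :
  all straight c -> code_at P l c ->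
  (forall s C, pre s -> repr s C ->
    repr (f s) (foldl (fun C i => exec i C) C c)) ->
  simulates pre P l c f.
Proof.
move=> sc hc H s C hs hl hr; exists (size c); have hc' := hc; rewrite -hl in hc'.
by have [e hp] := run_straight sc hc'; rewrite hp hl e; split=> //; apply: H.
Qed.

Lemma simulates_cat P l c1 c2 f g :
  simulates xpredT P l c1 f -> simulates xpredT P (l + size c1) c2 g ->
  simulates xpredT P l (c1 ++ c2) (g \o f).
Proof.
move=> h1 h2 s C _ hl hr; have [t1 [le1 p1 r1]] := h1 _ _ isT hl hr.
have [t2 [le2 p2 r2]] := h2 _ _ isT p1 r1.
exists (t2 + t1); rewrite iterD size_cat; split=> //; first by lia.
by rewrite p2 addnA.
Qed.

(** The test may leave its result in register 1 and change nothing else that [repr] sees. The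
    program counter 0 is a placeholder, since [repr] ignores it. *)
Lemma simulates_if P l tst c1 c2 (test : state -> bool) f g :
  all straight tst -> code_at P l (if_code l tst c1 c2) ->
  (forall s C, repr s C ->
    let C' := foldl (fun C i => exec i C) C tst in
    repr s (Config 0 (upd (reg C') 1 0) (mem C')) /\
    (reg C' 1 == 0) = ~~ test s) ->
  simulates test P (l + size tst).+2 c1 f ->
  simulates (predC test) P (l + size tst + size c1 + 3) c2 g ->
  simulates xpredT P l (if_code l tst c1 c2) (fun s => if test s then f s else g s).
Proof.
move=> st hc ht h1 h2 s C _ hl hr.
have hsz : size (if_code l tst c1 c2) = size tst + size c1 + 3 + size c2.
  by rewrite /if_code size_cat /= size_cat /=; lia.
case/code_at_cat: (hc) => ct /code_at_cons[cj /code_at_cons[ck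
  /code_at_cat[_ /code_at_cons[cl _]]]].
have ct' := ct; rewrite -hl in ct'; have [eC pC] := run_straight st ct'.
have [r0 tE] := ht _ _ hr; rewrite -eC in r0 tE.
move: {eC} r0 tE pC; rewrite hl.
case EC: (iter _ _ _) => [p R M] /= r0 tE hp; rewrite {p}hp in EC.
set d := l + size tst + size c1 + 3 in h2 cj cl.
case hs: (test s) tE => tE.
  pose C1 := Config (l + size tst).+2 (upd R 1 0) M.
  have e1 : iter (size tst + 2) (step P) C = C1.
    by rewrite addnC iterD EC /= (step_some _ _ cj) /= tE (step_some _ _ ck).
  have [t1 [le1 p1 r1]] := h1 s C1 hs erefl r0.
  exists (1 + t1 + (size tst + 2)); rewrite iterD e1 iterD hsz.
  case E1: (iter t1 (step P) C1) p1 r1 => [p R1 M1] /= -> r1.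
  rewrite /= (step_some _ _ cl) /=; split=> //; [by lia|by rewrite /d; lia].
pose C1 := Config d R M.
have e1 : iter (size tst + 1) (step P) C = C1.
  by rewrite addnC iterD EC /= (step_some _ _ cj) /= tE.
have rC1 : repr s C1.
  case: r0 => a1 [a0 a2 a3 a4] a5 a6; split=> //; split=> //=; exact/eqP.
have [t1 [le1 p1 r1]] := h2 s C1 (negbT hs) erefl rC1.
exists (t1 + (size tst + 1)); rewrite iterD e1 hsz; split=> //; first by lia.
by rewrite p1 /d; lia.
Qed.

Lemma comp_correct P (b : stm) l : code_at P l (comp l b) ->
  simulates xpredT P l (comp l b) (ex w b).
Proof.
elim: b l => [|x c|x y|x y|a x y|a x y|x y|b1 IH1 b2 IH2|x y b1 IH1 b2 IH2|x c b1 IH1 b2 IH2] l /= hc.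
- exact: simulates_straight.
- apply: simulates_straight => // s [p R M] _ [/= h1 [h0 h2 h3 h4] h5 h6]; split=> //= z.
  by rewrite /upd !eqSS h1.
- apply: simulates_straight => // s [p R M] _ [/= h1 [h0 h2 h3 h4] h5 h6]; split=> //= z.
  by rewrite /upd !eqSS h1 h2 addn0 h1.
- apply: simulates_straight => // s [p R M] _ [/= h1 [h0 h2 h3 h4] h5 h6]; split=> //= z.
  by rewrite /upd /= !eqSS !h1 addn1.
- apply: simulates_straight => // s [p R M] _ [/= h1 [h0 h2 h3 h4] h5 h6]; split=> //= z.
  rewrite /upd /= !eqSS !h1 h3 h4 addn0 -h6; case: eqP => // _; congr (M _); lia.
- apply: simulates_straight => // s [p R M] _ [/= h1 [h0 h2 h3 h4] h5 h6]; split=> //=.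
    move=> j hj; rewrite /upd /= h4 ifN; first by rewrite h5.
    by apply/eqP; lia.
  move=> b i; rewrite /upd /= /upd2 !h1 h3 h4 addn0 h6 -addr_inj.
  have -> : rg s x + rg s x + (rg s x + rg s x) + (rg s x + rg s x + (rg s x + rg s x)) + base + a
     = base + (8 * rg s x + a) by lia.
  by [].
(* The guard keeps reads inside the input: from address [base] on, the memory holds the arrays,
   whereas [w] is 0 there. *)
- have Hif := @simulates_if P l [:: Sub 1 3 y.+4] [:: Read x.+4 y.+4]
    [:: Const x.+4 0] (fun s => rg s y < base)
    (fun s => State (upd (rg s) x (w (rg s y))) (ar s))
    (fun s => State (upd (rg s) x 0) (ar s)) isT hc.
  case/code_at_cons: (hc) => _ /code_at_cons[_ /code_at_cons[_ /(@code_at_cat _ _ [:: _])[hc1 /code_at_cons[_ hc2]]]].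
  move=> s C _ hl hr.
  have [] := Hif _ _ _ s C isT hl hr.
  + move=> s' [p R M] /= [/= h1 [h0 h2 h3 h4] h5 h6]; split; last first.
      by rewrite /upd /= h1 h4 subn_eq0 leqNgt.
    by split=> //= z; rewrite /upd /= h1.
  + rewrite addn1; apply: simulates_straight => // s' [p R M] ys [/= h1 [h0 h2 h3 h4] h5 h6]; split=> //= z.
    by rewrite /upd !eqSS h1 h1 h5.
  + rewrite addnAC /= in hc2 *; apply: simulates_straight => //.
      by move: hc2; congr code_at; lia.
    move=> s' [p R M] ys [/= h1 [h0 h2 h3 h4] h5 h6]; split=> //= z.
    by rewrite /upd !eqSS h1.
  move=> t [t1 t2 t3]; exists t; split=> //.
  move: t3; case: ltnP => // h; rewrite w_base //.
- by case/code_at_cat: hc => hc1 hc2; apply: simulates_cat; [apply: IH1|apply: IH2].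
- case/code_at_cons: (hc) => _ /code_at_cons[_ /code_at_cons[_ /code_at_cat[hc1 /code_at_cons[_ hc2]]]].
  apply: simulates_if => //.
  + move=> s [p R M] /= [/= h1 [h0 h2 h3 h4] h5 h6]; split; last first.
      by rewrite /upd /= !h1 subn_eq0 leqNgt.
    by split=> //= z; rewrite /upd /= h1.
  + rewrite addn1 => s C _; exact: IH1.
  + set c1 := comp _ b1 in hc1 hc2 *.
    have e1 : l + 1 + size c1 + 3 = l + size c1 + 4 by lia.
    move=> s C _; rewrite /= e1; apply: IH2 => //.
    by move: hc2; congr code_at; lia.
- case/code_at_cons: (hc) => _ /code_at_cons[_ /code_at_cons[_ /code_at_cons[_ /code_at_cat[hc1 /code_at_cons[_ hc2]]]]].
  apply: simulates_if => //.
  + move=> s [p R M] /= [/= h1 [h0 h2 h3 h4] h5 h6]; split; last first.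
      by rewrite /upd /= !h1 subn_eq0 leqNgt.
    by split=> //= z; rewrite /upd /= h1.
  + rewrite addn2 => s C _; exact: IH1.
  + set c1 := comp _ b1 in hc1 hc2 *.
    have e1 : l + 2 + size c1 + 3 = l + size c1 + 5 by lia.
    move=> s C _; rewrite /= e1; apply: IH2 => //.
    by move: hc2; congr code_at; lia.
Qed.
End Simulation.

(** * Word size *)

Definition instr_const i := if i is Const _ c then c else 0.
Definition max_const (P : program) := \max_(i <- P) instr_const i.

Lemma onth_const P l i : onth P l = Some i -> instr_const i <= max_const P.
Proof.
rewrite /max_const; elim: P l => [|j P IH] [|l] //=; rewrite big_cons.
  by move=> [->]; rewrite leq_maxl.
by move/IH => h; rewrite leq_max h orbT.
Qed.

Lemma step_bounded P W C :
  word_bounded W C -> word_bounded (2 * W + max_const P) (step P C).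
Proof.
move=> h; rewrite /step.
case E: (onth P (pc C)) => [i|]; last by move=> j; have := h j; lia.
have := onth_const E; case: C h {E} => p R M h hi j.
have hj := h j; case: i hi => [r c|r s t|r s t|r s|r s|l|r l] /= hi; rewrite /upd;
  do ?case: ifP => _; try by (move: hj => /=; lia).
- by have := h s; have := h t; move: hj => /=; lia.
- by have := h s; have := h t; move: hj => /=; lia.
- by have := h (R s); move: hj => /=; lia.
- by have := h s; move: hj => /=; lia.
Qed.

(** The exponential factor is affordable because [t] will be at most the length of one pass, a
    constant of the program. *)
Lemma iter_step_bounded P W C t :
  word_bounded W C ->
  word_bounded (2 ^ t * (W + max_const P) - max_const P) (iter t (step P) C).
Proof.
move=> h; elim: t => [|t IH] /=; first by rewrite expn0 mul1n addnK.
move=> j; have := step_bounded P IH j.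
have : max_const P <= 2 ^ t * (W + max_const P).
  by rewrite -[X in X <= _]mul1n leq_mul ?expn_gt0 // leq_addl.
by rewrite expnS; lia.
Qed.

Definition state_bounded W s :=
  (forall x, rg s x <= W) /\ (forall a i, ar s a i <= W).

(** A block only adds a constant to the largest word, since no instruction combines two words. For
    tests, the sum stands in for the maximum of the branches. *)
Fixpoint growth b :=
  match b with
  | Cst _ c => c
  | Inc _ _ => 1
  | Seq b1 b2 | IfLt _ _ b1 b2 | IfLtc _ _ b1 b2 => growth b1 + growth b2
  | _ => 0
  end.

Lemma state_bounded_le W W' s :
  W <= W' -> state_bounded W s -> state_bounded W' s.
Proof. by move=> le [h1 h2]; split=> *; apply: leq_trans le. Qed.

Lemma ex_bounded w b W s : (forall i, w i <= W) ->
  state_bounded W s -> state_bounded (W + growth b) (ex w b s).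
Proof.
elim: b W s => [|x c|x y|x y|a x y|a x y|x y|b1 IH1 b2 IH2|x y b1 IH1 b2 IH2|x c b1 IH1 b2 IH2] W s hw hs /=.
all: try by [case: hs => h1 h2; split=> * /=; rewrite ?/upd ?/upd2; try case: ifP => _;
  rewrite ?addn0 ?addn1 ?ltnS ?leq_addl // ; try (by apply: leq_trans (leq_addr _ _)); try (by apply: leqW)].
- rewrite addnA; apply: IH2; last exact: IH1.
  by move=> i; apply: leq_trans (hw i) (leq_addr _ _).
- by case: ifP => _; [apply: state_bounded_le (IH1 _ _ hw hs)|apply: state_bounded_le (IH2 _ _ hw hs)]; lia.
- by case: ifP => _; [apply: state_bounded_le (IH1 _ _ hw hs)|apply: state_bounded_le (IH2 _ _ hw hs)]; lia.
Qed.

Lemma repr_bounded w base W s C : (forall i, w i <= W) -> base <= W ->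
  state_bounded W s -> repr w base s C -> word_bounded W C.
Proof.
move=> hw hb [s1 s2] [h1 [h0 h2 h3 h4] h5 h6] i; split.
  by case: i => [|[|[|[|i]]]] //; rewrite ?h0 ?h1 ?h2 ?h3 ?h4.
case: (ltnP i base) => hi; first by rewrite h5.
have -> : i = base + (8 * ((i - base) %/ 8) + Ordinal (ltn_pmod (i - base) (isT : 0 < 8))).
  by rewrite /= mulnC -divn_eq subnKC.
by rewrite h6.
Qed.

Lemma word_bounded_le W W' C : W <= W' -> word_bounded W C -> word_bounded W' C.
Proof. by move=> le h i; have := h i; lia. Qed.

(** Address 1 holds the number [m] of arcs; register 3 receives the length [2 + 2 * m] of the
    input. *)
Definition setup_code : seq instr :=
  [:: Const 1 1; Read 3 1; Add 3 3 3; Const 1 2; Add 3 3 1; Const 1 0].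

Definition loop_program (b : stm) : program :=
  setup_code ++ comp 6 b ++ [:: JumpZ 5 6; Add 0 4 1].

(* The compiled program repeats the block until source register 1 is nonzero
   and returns source register 0. *)
Theorem loop_program_correct (b : stm) : exists c, forall w t W,
  let s i := iter i (ex (nth 0 w) b) state0 in
  size w = 2 + 2 * nth 0 w 1 ->
  (forall i, nth 0 w i <= W) -> size w <= W ->
  0 < t -> (forall i, 0 < i < t -> rg (s i) 1 = 0) -> rg (s t) 1 != 0 ->
  answers_within (loop_program b) w (c * t.+1) (c * (W + t.+1))
    (rg (s t) 0 != 0).
Proof.
set P := loop_program b; set cs := size (comp 6 b); set g := growth b.
set mc := max_const P; set d := 2 ^ (cs + 8).
(* [cs + 8] covers the machine steps of one pass together with set-up or exit, so [d] is the factor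
   by which words may grow within it. *)
exists (cs + 8 + d * (g + mc + 1)) => w t W s sw hw hW t0 hlt ht.
set base := size w.
have code : code_at P 0 (setup_code ++ comp 6 b ++ [:: JumpZ 5 6; Add 0 4 1]) by [].
case/code_at_cat: code => code1 /code_at_cat[code2 /code_at_cons[code3 /code_at_cons[code4 _]]].
have e6 : 0 + size setup_code = 6 by [].
rewrite e6 -/cs in code2 code3 code4.
pose B := d * (W + t * g + mc).
(* Each pass starts again from the additive bound [W + j * g] of its source state, so doubling does
   not accumulate over passes. *)
have bnd j C : j <= t -> word_bounded (W + j * g) C ->
    forall i, i <= cs + 8 -> word_bounded B (iter i (step P) C).
  move=> hj hC i hi x; have := iter_step_bounded P i hC x.
  suff : 2 ^ i * (W + j * g + mc) <= B by rewrite -/mc; lia.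
  by rewrite /B leq_mul ?leq_exp2l // leq_add2r leq_add2l leq_mul2r hj orbT.
have sB j : state_bounded (W + j * g) (s j).
  elim: j => [|j IH]; first by split.
  rewrite mulSn addnCA addnC /s iterS; apply: ex_bounded => // i.
  by apply: leq_trans (hw i) (leq_addr _ _).
have wB : forall i, base <= i -> nth 0 w i = 0 by move=> i; apply: nth_default.
have rB j C : repr (nth 0 w) base (s j) C -> word_bounded (W + j * g) C.
  apply: repr_bounded => //; last exact: leq_trans (leq_addr _ _).
  by move=> i; apply: leq_trans (hw i) (leq_addr _ _).
have iter_ok j : j < t -> exists tau, [/\ tau <= 6 + j * (cs + 1),
    pc (run P w tau) = 6, repr (nth 0 w) base (s j) (run P w tau)
    & forall i, i <= tau -> word_bounded B (run P w i)].
  elim: j => [|j IH] hj.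
    exists 6; have [e1 e2] := run_straight (P := P) (c := setup_code) (C := init w) isT code1.
    have r6 : repr (nth 0 w) base (s 0) (run P w 6).
      rewrite /run e1 /=; split=> //=.
        by split=> //; rewrite /upd /= -/base [base]sw; lia.
      by move=> a i; rewrite wB // leq_addr.
    split=> //; move=> i hi; apply: (bnd 0); rewrite ?mul0n ?addn0 //; last by lia.
    by move=> x; split=> /=.
  have [tau [h1 h2 h3 h4]] := IH (ltnW hj).
  have [t1 [l1 p1 r1]] := comp_correct wB code2 isT h2 h3.
  exists (t1.+1 + tau); rewrite /run iterD -/(run P w tau).
  set C1 := iter t1 (step P) (run P w tau) in p1 r1.
  have e : iter t1.+1 (step P) (run P w tau) = Config 6 (reg C1) (mem C1).
    rewrite iterS -/C1; case: C1 p1 r1 => p R M /= -> [/= h _ _ _].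
    by rewrite (step_some _ _ code3) /= h -iterS -/(s j.+1) hlt.
  rewrite e; split=> //; first by rewrite mulSn; lia.
  move=> i hi; case: (leqP i tau) => hit; first exact: h4.
  rewrite -(subnK (ltnW hit)) iterD; apply: (bnd j); [lia|exact: rB|lia].
have [tau [h1 h2 h3 h4]] := iter_ok t.-1 ltac:(lia).
have [t1 [l1 p1 r1]] := comp_correct wB code2 isT h2 h3.
set C1 := iter t1 (step P) (run P w tau) in p1 r1.
have e : iter t1.+2 (step P) (run P w tau) =
    Config (6 + cs).+2 (upd (reg C1) 0 (reg C1 4 + reg C1 1)) (mem C1).
  rewrite !iterS -/C1; case: C1 p1 r1 => p R M /= -> [/= h _ _ _].
  rewrite (step_some _ _ code3) /= h -iterS prednK // -/(s t) (negbTE ht).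
  by rewrite (step_some _ _ code4).
exists (t1.+2 + tau); rewrite /run iterD -/(run P w tau) e /=.
case: r1 => /= r1 [r2 r3 r4 r5] _ _; split.
- by move: h1; rewrite -{2}(prednK t0) => h1; nia.
- by rewrite /halted /= /P /loop_program !size_cat /= -/cs; lia.
- by rewrite /upd /= r1 r3 addn0 -iterS prednK.
move=> i hi; apply: (@word_bounded_le B).
  rewrite /B mulnDl -mulnA; apply: leq_trans (leq_addl _ _); rewrite leq_mul2l.
  by apply/orP; right; nia.
case: (leqP i tau) => hit; first exact: h4.
rewrite -(subnK (ltnW hit)) iterD; apply: (bnd t.-1); [lia|exact: rB|lia].
Qed.

Lemma leq_card_bigcup (I T : finType) (P : pred I) (F : I -> {set T}) :
  #|\bigcup_(i | P i) F i| <= \sum_(i | P i) #|F i|.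
Proof.
elim/big_rec2: _ => [|i m A _ le]; first by rewrite cards0.
apply: leq_trans (leq_card_setU _ _).1 _; by rewrite leq_add2l.
Qed.

(** * Out-trees and reachability *)

Section Trees.
Variable V : finType.
Implicit Types (D : digraph V) (e : rel V) (L W : {set V}).

Definition arcrel (F : {set V * V}) : rel V := fun u v => (u, v) \in F.

Definition restr D W : rel V :=
  fun u v => [&& (u, v) \in arcs D, u \in W & v \in W].

Lemma connect_restr D W r v :
  r \in W -> connect (restr D W) r v -> v \in W.
Proof.
move=> rW /connectP[p]; elim: p r rW => [|x p IH] r rW /=; first by move=> _ ->.
by case/andP=> /and3P[_ _ xW]; apply: IH.
Qed.

(** * Out-trees given by parent functions *)

Section ParentTree.
Variables (D : digraph V) (W : {set V}) (r : V) (par : V -> V) (d : V -> nat).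
Hypothesis rW : r \in W.
Hypothesis parP : forall v, v \in W -> v != r ->
  [/\ par v \in W, (par v, v) \in arcs D & d (par v) < d v].

Definition parent_tree := (W, [set (par v, v) | v in W :\ r]).

Lemma parent_treeE u v :
  ((u, v) \in parent_tree.2) = [&& v \in W, v != r & u == par v].
Proof.
apply/imsetP/and3P => [[x /setD1P[xr xW] [-> ->]]|[vW vr /eqP->]] //.
by exists v => //; apply/setD1P.
Qed.

(** On a cycle, both neighbours of a vertex with largest [d] would be its parent. *)
Lemma parent_tree_acyclic : acyclic (underlying parent_tree.2).
Proof.
have up x y : underlying parent_tree.2 x y -> d y <= d x -> y = par x.
  rewrite /underlying !parent_treeE => /orP[/and3P[h1 h2 /eqP h3]|/and3P[_ _ /eqP]//].
  by have [_ _] := parP h1 h2; rewrite -h3; lia.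
apply/acyclicP => s /andP[cs us]; rewrite leqNgt; apply/negP => s2.
have s0 : exists x, x \in s by case: s s2 {cs us} => // x s; exists x; rewrite inE eqxx.
have [x xs xmax] : exists2 x, x \in s & forall y, y \in s -> d y <= d x.
  have [x0 x0s] := s0; case: (arg_maxnP (P := [in s]) d x0s) => x xs h.
  by exists x.
have [i p sE] := rot_to xs.
have cp : cycle (underlying parent_tree.2) (x :: p) by rewrite -sE rot_cycle.
have up' : uniq (x :: p) by rewrite -sE rot_uniq.
have sp : size (x :: p) > 2 by rewrite -sE size_rot.
have xmax' y : y \in p -> d y <= d x.
  by move=> yp; apply: xmax; rewrite -(mem_rot i) sE inE yp orbT.
case: p cp up' sp xmax' {sE} => [|y p] //; case/lastP: p => [|p z] // cp u3 _ xm.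
move: cp; rewrite /= rcons_path last_rcons => /and3P[exy _ ezx].
have y1 : y = par x by apply: up => //; apply: xm; rewrite inE eqxx.
have z1 : z = par x.
  apply: up; first by rewrite /underlying orbC.
  by apply: xm; rewrite inE mem_rcons inE eqxx orbT.
by move: u3; rewrite /= y1 z1 mem_rcons inE eqxx !andbF.
Qed.

Lemma parent_tree_out_tree : out_tree D parent_tree.
Proof.
apply/and3P; split; [apply/andP; split|apply/and4P; split|].
- apply/subsetP => -[u v]; rewrite parent_treeE => /and3P[h1 h2 /eqP->].
  by have [] := parP h1 h2.
- apply/forallP => -[u v]; apply/implyP; rewrite parent_treeE => /and3P[h1 h2 /eqP->] /=.
  by rewrite h1; have [->] := parP h1 h2.
- by apply/set0Pn; exists r.
- apply/forallP => u; apply/forallP => v; rewrite !parent_treeE.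
  apply/negP => /andP[/and3P[h1 h2 /eqP h3] /and3P[g1 g2 /eqP g3]].
  by have [_ _] := parP h1 h2; have [_ _] := parP g1 g2; rewrite -h3 -g3; lia.
- have cs : connect_sym (underlying parent_tree.2).
    by apply: sym_connect_sym => u v; rewrite /underlying orbC.
  have cr v : v \in W -> connect (underlying parent_tree.2) r v.
    have [m] := ubnP (d v); elim: m v => // m IH v hm vW.
    have [->|vr] := eqVneq v r; first exact: connect0.
    have [pW _ dlt] := parP vW vr.
    apply: connect_trans (IH _ _ pW) _; first by lia.
    by apply: connect1; rewrite /underlying parent_treeE vW vr eqxx.
  apply/forallP => u; apply/implyP => uW; apply/forallP => v; apply/implyP => vW.
  by apply: connect_trans (cr _ vW); rewrite cs; apply: cr.
- exact: parent_tree_acyclic.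
apply/cards1P; exists r; apply/setP => v; rewrite !inE /=.
apply/andP/eqP => [[vW /eqP/cards0_eq v0]|->].
  apply/eqP/negPn/negP => vr; move/setP/(_ (par v)): v0.
  by rewrite !inE parent_treeE vW vr eqxx.
split=> //; apply/eqP/eqP; rewrite cards_eq0; apply/eqP/setP => u.
by rewrite !inE parent_treeE eqxx andbF.
Qed.

Lemma parent_tree_leaf v :
  v \in W -> (forall u, u \in W -> u != r -> par u != v) ->
  v \in leaves parent_tree.
Proof.
move=> vW h; rewrite !inE vW /= cards_eq0; apply/eqP/setP => u.
rewrite !inE parent_treeE; apply/negP => /and3P[uW ur /eqP vE].
by have := h u uW ur; rewrite vE eqxx.
Qed.

Lemma parent_tree_leaves_gt0 : 0 < #|leaves parent_tree|.
Proof.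
apply/card_gt0P; case: (arg_maxnP (P := [in W]) d rW) => v vW h.
exists v; apply: parent_tree_leaf => // u uW ur; apply/eqP => pE.
by have [_ _] := parP uW ur; rewrite pE; have := h u uW; lia.
Qed.
End ParentTree.

(** [d] is the distance from [r], and [par v] an in-neighbour that is closer to [r]; the last but
    one vertex of a shortest path shows that there is one. *)
Lemma shortest_path_parent e r : exists par d, forall v,
  connect e r v -> v != r ->
  [/\ e (par v) v, connect e r (par v) & d (par v) < d v].
Proof.
pose P v n := [exists t : n.-tuple V, path e r t && (last r t == v)].
have PP v p : path e r p -> last r p = v -> P v (size p).
  move=> h1 h2; apply/existsP; exists (in_tuple p); rewrite h1 /=; exact/eqP.
have H v : {n | connect e r v -> P v n /\ forall m, P v m -> n <= m}.
  case: (boolP (connect e r v)) => [h|_]; last by exists 0.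
  have ex : exists n, P v n by case/connectP: h => p h1 h2; exists (size p); apply: PP.
  by exists (ex_minn ex) => _; case: ex_minnP.
have [d dP] : exists d : V -> nat, forall v,
    connect e r v -> P v (d v) /\ forall m, P v m -> d v <= m.
  by exists (fun v => sval (H v)) => v; apply: (svalP (H v)).
have G v : {u | connect e r v -> v != r -> [/\ e u v, connect e r u & d u < d v]}.
  case: (pickP (fun u => [&& e u v, connect e r u & d u < d v])) => [u /and3P[]|none].
    by exists u.
  exists v => cv vr; exfalso.
  have [] := dP v cv; case E: (d v) none => [|n] none.
    move=> /existsP[t /andP[_ /eqP]]; rewrite tuple0 /= => rv.
    by rewrite rv eqxx in vr.
  move=> /existsP[[t /= st]]; case/lastP: t st => // t x; rewrite size_rcons eqSS last_rcons rcons_path.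
  move=> /eqP st /andP[/andP[pt ex] /eqP xv] _; rewrite {}xv in ex.
  have cl : connect e r (last r t) by apply/connectP; exists t.
  have := none (last r t); rewrite ex cl /= => /negP; apply.
  have [_ /(_ n)] := dP (last r t) cl; rewrite ltnS; apply.
  by rewrite -st; apply: PP.
by exists (fun v => sval (G v)), d => v; apply: (svalP (G v)).
Qed.

(** A breadth-first tree with [L] hung below it. The last conjunct serves [L = set0], where [L]
    itself supplies no leaf. *)
Lemma out_tree_of_reach D e r L :
  (forall u v, e u v -> (u, v) \in arcs D) ->
  (forall l, l \in L -> ~~ connect e r l) ->
  (forall l, l \in L -> exists2 x, connect e r x & (x, l) \in arcs D) ->
  exists T, [/\ out_tree D T, T.1 = [set v | connect e r v] :|: L,
    L \subset leaves T & 0 < #|leaves T|].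
Proof.
move=> eD Lr Lx; have [par [d parP]] := shortest_path_parent e r.
have G v : {x | v \in L -> connect e r x && ((x, v) \in arcs D)}.
  case: (pickP (fun x => connect e r x && ((x, v) \in arcs D))) => [x|none].
    by exists x.
  by exists v => /Lx[x h1 h2]; have := none x; rewrite h1 h2.
have [g gP] : exists g : V -> V, forall v, v \in L -> connect e r (g v) && ((g v, v) \in arcs D).
  by exists (fun v => sval (G v)) => v; apply: (svalP (G v)).
pose W := [set v | connect e r v] :|: L.
pose par' v := if v \in L then g v else par v.
pose M := \max_v d v.
(* The depth [M.+1] puts [L] below all other vertices. *)
pose d' v := if v \in L then M.+1 else d v.
have Lc l : connect e r l -> l \in L = false by move=> h; apply/negP => /Lr; rewrite h.
have rW : r \in W by rewrite !inE connect0.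
have HP v : v \in W -> v != r ->
    [/\ par' v \in W, (par' v, v) \in arcs D & d' (par' v) < d' v].
  rewrite inE /par' /d' => /orP[|vL].
    rewrite inE => cv vr; have [h1 h2 h3] := parP _ cv vr.
    by rewrite (Lc _ cv) !inE h2 (Lc _ h2); split=> //; apply: eD.
  move=> vr; rewrite vL; have /andP[h1 h2] := gP v vL.
  by rewrite !inE h1 (Lc _ h1); split=> //; rewrite ltnS /M leq_bigmax.
exists (parent_tree W r par'); split=> //.
- exact: parent_tree_out_tree HP.
- apply/subsetP => l lL; apply: parent_tree_leaf; first by rewrite inE lL orbT.
  move=> u uW ur; apply/eqP => pE.
  suff : connect e r (par' u) by rewrite pE => /Lc; rewrite lL.
  rewrite /par'; case: ifP => [uL|uL]; first by have /andP[] := gP u uL.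
  by move: uW; rewrite !inE uL orbF => cu; have [] := parP _ cu ur.
exact: parent_tree_leaves_gt0 HP.
Qed.

Lemma leq_ell D e r L :
  (forall u v, e u v -> (u, v) \in arcs D) ->
  (forall l, l \in L -> ~~ connect e r l) ->
  (forall l, l \in L -> exists2 x, connect e r x & (x, l) \in arcs D) ->
  #|L| <= ell D.
Proof.
move=> h1 h2 h3; have [T [hT _ hL _]] := out_tree_of_reach h1 h2 h3.
apply: leq_trans (subset_leq_card hL) _.
exact: (leq_bigmax_cond (F := fun T => #|leaves T|)).
Qed.

Lemma leq_ell_restr D W r L : r \in W -> [disjoint L & W] ->
  (forall l, l \in L -> exists2 x, connect (restr D W) r x & (x, l) \in arcs D) ->
  #|L| <= ell D.
Proof.
move=> rW dL; apply: leq_ell => [u v /and3P[] //|l lL].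
apply/negP => /(connect_restr rW) lW.
by have := disjointFr dL lL; rewrite lW.
Qed.

(* Walking backwards along the arcs of T can only stop at the root, since a
   walk that repeats a vertex would close a cycle. *)
Lemma out_tree_root D T : out_tree D T ->
  exists2 r, r \in T.1 & forall v, v \in T.1 -> connect (arcrel T.2) r v.
Proof.
case/and3P => /andP[_ /forallP sub] /and4P[_ /forallP anti _ /acyclicP acyc].
have {}anti u v : (u, v) \in T.2 -> (v, u) \in T.2 -> False.
  by move=> h1 h2; move/forallP: (anti u) => /(_ v); rewrite h1 h2.
case/cards1P => r rE.
have rT : r \in T.1 by have : r \in [set r] by [rewrite inE]; rewrite -rE inE => /andP[].
exists r => // v0 v0T; apply/negPn/negP => n0.
pose f v := odflt v [pick u | (u, v) \in T.2].
have fP v : v \in T.1 -> ~~ connect (arcrel T.2) r v ->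
    [/\ (f v, v) \in T.2, f v \in T.1 & ~~ connect (arcrel T.2) r (f v)].
  move=> vT nv.
  have vr : v != r by apply: contraNneq nv => ->.
  have fv : (f v, v) \in T.2.
    rewrite /f; case: pickP => //= none; case/negP: vr.
    rewrite -in_set1 -rE inE vT cards_eq0; apply/eqP/setP => u.
    by rewrite !inE none.
  split=> //; first by have := sub (f v, v); rewrite fv /= => /andP[].
  by apply: contra nv => h; apply: connect_trans h _; apply: connect1.
have itP i : iter i f v0 \in T.1 /\ ~~ connect (arcrel T.2) r (iter i f v0).
  by elim: i => [|i [h1 h2]] //=; have [] := fP _ h1 h2.
have itA i : (iter i.+1 f v0, iter i f v0) \in T.2.
  by have [h1 h2] := itP i; have [] := fP _ h1 h2.
have [i lti iE] : exists2 i, i < order f v0 & iter (order f v0) f v0 = iter i f v0.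
  by apply/trajectP; have := looping_order f v0; rewrite /looping.
set o := order f v0 in lti iE.
pose c := traject f (iter i f v0) (o - i).
have cu : uniq c.
  have := orbit_uniq f v0; rewrite /orbit -/o -(subnKC (ltnW lti)) trajectD cat_uniq.
  by case/and3P.
have cc : cycle (underlying T.2) c.
  rewrite /c -(@prednK (o - i)) ?subn_gt0 // trajectS /=.
  have pth m n : path (underlying T.2) (iter m f v0) (traject f (iter m.+1 f v0) n).
    elim: n m => // n IH m; rewrite trajectS /=; apply/andP; split; last exact: IH m.+1.
    by rewrite /underlying; apply/orP; right; apply: (itA m).
  rewrite rcons_path; apply/andP; split; first exact: pth.
  rewrite last_traject -iterD -iE /underlying; apply/orP; right.
  by have := itA ((o - i).-1 + i); have -> : ((o - i).-1 + i).+1 = o by lia.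
have := acyc c; rewrite /ucycle /ucycleb cc cu size_traject => /(_ isT) c2.
(* [acyclic] tolerates cycles of length 1 and 2; these are excluded because no arc of [T] occurs
   with its opposite, and a loop is its own opposite. *)
have : (o - i == 1) || (o - i == 2) by lia.
case/orP=> /eqP oi.
- have := itA i; have -> : i.+1 = o by lia.
  by rewrite iE => h; apply: (anti _ _ h h).
- have := itA i.+1; have -> : i.+2 = o by lia.
  by rewrite iE => h; apply: anti h (itA i).
Qed.

(** * Roots, and leaf sets in place of out-trees *)

Definition has_root D := exists r, forall v, connect (arcrel D) r v.

Lemma has_rootP D : has_root D <-> 0 < ell_s D.
Proof.
split=> [[r hr]|].
  have [||T [h1 h2 _ h4]] := @out_tree_of_reach D (arcrel D) r set0 (fun _ _ => id).
  - by move=> l; rewrite inE.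
  - by move=> l; rewrite inE.
  apply: leq_trans h4 _.
  apply: (leq_bigmax_cond (F := fun T => #|leaves T|)); rewrite /out_branching h1 h2 setU0.
  by apply/eqP/setP => v; rewrite !inE hr.
case: (pickP (out_branching D)) => [T /andP[hT /eqP TV] _|none].
  have [r _ hr] := out_tree_root hT; exists r => v.
  have := hr v; rewrite TV inE => /(_ isT); apply: connect_sub => x y xy.
  apply: connect1; case/and3P: hT => /andP[/subsetP h _] _ _; exact: h.
by rewrite /ell_s big_pred0.
Qed.

(** No tree has to be guessed: the root and the leaf set suffice, as the tree between them can be
    any spanning tree of what the root reaches outside [L]. *)
Definition leafy k D := exists r L, [/\ r \notin L, k <= #|L|
  & forall l, l \in L ->
    exists2 x, connect (restr D (~: L)) r x & (x, l) \in arcs D].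

(** A single vertex is an out-tree whose root is a leaf, which [r \notin L] forbids; hence the bound
    on [k]. *)
Lemma leafyP k D : 1 < k -> leafy k D <-> k <= ell D.
Proof.
move=> k1; split=> [[r [L [rL kL hL]]]|].
  apply: leq_trans kL _; apply: (leq_ell_restr (r := r) (W := ~: L)) => //.
    by rewrite in_setC.
  by rewrite disjoints_subset setCK.
have [T0 T0P | none] := pickP (out_tree D); last by rewrite /ell big_pred0 // leqNgt (ltnW k1).
have [T hT <-] : exists2 T, out_tree D T & #|leaves T| = ell D.
  have [|T hT e] := @eq_bigmax_cond _ (out_tree D) (fun T => #|leaves T|).
    by apply/card_gt0P; exists T0.
  by exists T => //; rewrite -e.
move=> kT; have [r rT hr] := out_tree_root hT.
have nl u v : (u, v) \in T.2 -> u \notin leaves T.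
  move=> uv; rewrite inE negb_and; apply/orP; right; rewrite -lt0n.
  by apply/card_gt0P; exists v; rewrite inE.
have TD u v : (u, v) \in T.2 -> (u, v) \in arcs D.
  by case/and3P: hT => /andP[/subsetP h _] _ _; apply: h.
have path_nl p x l : path (arcrel T.2) x (rcons p l) ->
    path (restr D (~: leaves T)) x p.
  elim: p x => [|y p IH] x //= /andP[xy yp]; rewrite IH // /restr TD // !in_setC (nl _ _ xy) !andbT /=.
  by case: p yp {IH} => [|z p] /= /andP[yz _]; apply: (nl _ _ yz).
have reach l : l \in leaves T -> l != r ->
    exists2 x, connect (restr D (~: leaves T)) r x & (x, l) \in T.2.
  move=> lL lr; have /hr/connectP[p hp lE] : l \in T.1 by move: lL; rewrite inE => /andP[].
  case/lastP: p hp lE => [|p z] hp; first by move=> e; rewrite e eqxx in lr.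
  rewrite last_rcons => lE; subst z; exists (last r p).
    by apply/connectP; exists p => //; apply: path_nl hp.
  by move: hp; rewrite rcons_path => /andP[].
(* A second leaf has to be reached from [r], so [r] has an out-arc in [T]. *)
have rL : r \notin leaves T.
  apply/negP => rL; have : 1 < #|leaves T| by apply: leq_trans kT.
  rewrite (cardD1 r) rL ltnS => /card_gt0P[l]; rewrite inE => /andP[lr lL].
  have [x] := reach l lL lr; case/connectP => -[|y p] /=.
    by move=> _ -> /nl; rewrite rL.
  by rewrite /restr in_setC rL /= andbF.
exists r, (leaves T); split=> // l lL.
have lr : l != r by apply: contraNneq rL => <-.
by have [x h1 h2] := reach l lL lr; exists x => //; apply: TD.
Qed.

(** A root makes [ell_s D] positive, so [calL D] yields [ell_s D = ell D]. For [k = 1] positivity is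
    already the answer. *)
Lemma leq_ell_s k D : 0 < k -> calL D ->
  k <= ell_s D <-> has_root D /\ (k = 1 \/ leafy k D).
Proof.
move=> k0 hD; rewrite has_rootP; split.
  move=> hk; have s0 := leq_trans k0 hk; split=> //.
  case: (ltnP 1 k) => k1; last by left; lia.
  by right; apply/leafyP => //; case: hD => [h|<-] //; rewrite h in s0.
move=> [h0 [-> //|hl]]; case: (ltnP 1 k) => k1; last by lia.
by case: hD => [h|->]; [rewrite h in h0|apply/leafyP].
Qed.

(** * Cuts of a search order *)

Definition search_order D x0 (q : seq V) := forall i, 0 < i < size q ->
  exists2 j, j < i & (nth x0 q j, nth x0 q i) \in arcs D.

(** From the first to the last position that touches it, a vertex must occupy a slot. *)
Definition touches D x0 (q : seq V) i v :=
  (nth x0 q i == v) || ((nth x0 q i, v) \in arcs D).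

Section Cuts.
Variables (D : digraph V) (x0 : V) (q : seq V).
Hypotheses (q_uniq : uniq q) (q_all : forall v, v \in q).
Hypothesis q_order : search_order D x0 q.

Let pos v := index v q.
Let pos_lt v : pos v < size q. Proof. by rewrite index_mem. Qed.
Let nth_pos v : nth x0 q (pos v) = v. Proof. exact: nth_index. Qed.

Definition prefix_set c := [set v | pos v < c].
Definition suffix_set c := [set v | c <= pos v].
Definition fwd_heads c :=
  [set v in suffix_set c | [exists x in prefix_set c, (x, v) \in arcs D]].
Definition bwd_heads c :=
  [set v in prefix_set c | [exists x in suffix_set c, (x, v) \in arcs D]].

Lemma card_fwd_heads c : 0 < c -> #|fwd_heads c| <= ell D.
Proof.
move=> c0; have [->|/set0Pn[f]] := eqVneq (fwd_heads c) set0; first by rewrite cards0.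
rewrite !inE => /andP[hf _]; have q0 : 0 < size q by apply: leq_trans (pos_lt f).
apply: (leq_ell_restr (W := prefix_set c) (r := nth x0 q 0)).
- by rewrite inE /pos index_uniq.
- rewrite disjoints_subset; apply/subsetP => v; rewrite !inE -leqNgt.
  by case/andP.
move=> l; rewrite inE => /andP[_ /existsP[x]]; rewrite inE => /andP[xc xl].
exists x => //; have [m] := ubnP (pos x); elim: m x xc {xl} => // m IH x xc xm.
have [px|px] := posnP (pos x); first by rewrite -px nth_pos connect0.
have [|j jx] := q_order (i := pos x); first by rewrite px pos_lt.
rewrite nth_pos => yx; have pj : pos (nth x0 q j) = j.
  by rewrite /pos index_uniq //; apply: ltn_trans jx (pos_lt x).
apply: connect_trans (IH (nth x0 q j) _ _) _; rewrite ?pj; [lia|lia|].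
by apply: connect1; rewrite /restr yx !inE pj; lia.
Qed.

(** Follow the search parents of [x] back until the next one lies before the cut. *)
Lemma suffix_reach c x : 0 < c -> c <= pos x ->
  exists2 f, f \in fwd_heads c & connect (restr D (suffix_set c)) f x.
Proof.
move=> c0; have [m] := ubnP (pos x); elim: m x => // m IH x xm cx.
have [|j jx] := q_order (i := pos x); first by rewrite pos_lt andbT; lia.
rewrite nth_pos => yx; have pj : pos (nth x0 q j) = j.
  by rewrite /pos index_uniq //; apply: ltn_trans jx (pos_lt x).
case: (ltnP j c) => jc.
  exists x; last exact: connect0.
  rewrite !inE cx; apply/existsP; exists (nth x0 q j); by rewrite inE pj jc.
have [||f h1 h2] := IH (nth x0 q j); rewrite ?pj //; first by lia.
exists f => //; apply: connect_trans h2 _; apply: connect1.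
by rewrite /restr yx !inE pj cx jc.
Qed.

Lemma card_bwd_heads c : #|bwd_heads c| <= ell D * ell D.
Proof.
have [->|c0] := posnP c.
  by rewrite (_ : bwd_heads 0 = set0) ?cards0 //; apply/setP => v; rewrite !inE.
pose Bk f := [set v in prefix_set c |
  [exists x, connect (restr D (suffix_set c)) f x && ((x, v) \in arcs D)]].
have Bk_le f : f \in fwd_heads c -> #|Bk f| <= ell D.
  rewrite inE => /andP[fs _]; apply: (leq_ell_restr fs).
    by rewrite disjoints_subset; apply/subsetP => v; rewrite !inE -ltnNge => /andP[].
  by move=> l; rewrite inE => /andP[_ /existsP[x /andP[h1 h2]]]; exists x.
apply: (@leq_trans (\sum_(f in fwd_heads c) #|Bk f|)); last first.
  apply: (@leq_trans (\sum_(f in fwd_heads c) ell D)); first exact: leq_sum.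
  by rewrite sum_nat_const leq_mul2r card_fwd_heads ?orbT.
apply: leq_trans (leq_card_bigcup _ _); apply: subset_leq_card.
apply/subsetP => v; rewrite inE => /andP[vp /existsP[x /andP[xs xv]]].
rewrite inE in xs; have [f hf fx] := suffix_reach c0 xs.
apply/bigcupP; exists f => //; rewrite inE vp; apply/existsP; exists x.
by rewrite fx.
Qed.

(** The vertex at [i0] accounts for the successor. An active vertex placed earlier is the head of an
    arc from [i0] or later, one placed later the head of an arc from [i0] or earlier; so the cuts
    just before and just after [i0] both occur. *)
Lemma card_active (A : {set V}) i0 :
  (forall v, v \in A ->
    (exists2 i, i <= i0 & touches D x0 q i v) /\
    (exists2 j, i0 <= j < size q & touches D x0 q j v)) ->
  #|A| <= (ell D * ell D + ell D).+1.
Proof.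
move=> hA; apply: (@leq_trans #|nth x0 q i0 |: (bwd_heads i0 :|: fwd_heads i0.+1)|).
  apply: subset_leq_card; apply/subsetP => v vA.
  have [[i hi ti] [j /andP[hj sj] tj]] := hA v vA.
  have pq a : a < size q -> pos (nth x0 q a) = a by move=> h; rewrite /pos index_uniq.
  have si : i < size q by apply: leq_ltn_trans sj; apply: leq_trans hj.
  rewrite !in_setU in_set1; case: (ltngtP (pos v) i0) => pv; last first.
  - by rewrite -pv nth_pos eqxx.
  - apply/orP; right; apply/orP; right; rewrite !inE pv.
    case/orP: ti => [/eqP ti|ti]; first by move: pv; rewrite -ti pq //; lia.
    by apply/existsP; exists (nth x0 q i); rewrite inE pq // ti andbT ltnS.
  apply/orP; right; apply/orP; left; rewrite !inE pv.
  case/orP: tj => [/eqP tj|tj]; first by move: pv; rewrite -tj pq //; lia.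
  by apply/existsP; exists (nth x0 q j); rewrite inE pq // tj andbT.
apply: leq_trans (leq_card_setU _ _).1 _; rewrite cards1 add1n ltnS.
apply: leq_trans (leq_card_setU _ _).1 _.
by apply: leq_add; [apply: card_bwd_heads|apply: card_fwd_heads].
Qed.
End Cuts.
End Trees.

(** * A finite automaton for the existence of many leaves *)

(* [leafy k D] holds iff some labelling of the vertices, with one root and at
   least k leaves, is such that every vertex set X that contains the root, no
   leaf, and the heads outside L of the arcs leaving X, sends an arc to each
   leaf. For a fixed labelling and a fixed X this is checked in one pass over
   the arcs; the two quantifiers are handled by two powerset constructions. *)
Section Automaton.
Variables k K : nat.

Definition label := option bool.
Definition is_leaf (l : label) := l == Some true.
Definition is_root (l : label) := l == Some false.

(* Number of leaves up to k, number of roots up to 2, X is not admissible, some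
   discarded leaf has no arc from X; and for each slot the label of its vertex,
   its membership in X, and whether it has received an arc from X. *)
Definition check_state : Type :=
  ('I_k.+1 * 'I_3 * bool * bool * {ffun 'I_K -> label * bool * bool})%type.

Definition empty_slot : label * bool * bool := (None, false, false).

Definition check_new (a : 'I_K) (l : label) (x : bool) (s : check_state) :
    check_state :=
  let: (c, r, bad, unhit, f) := s in
  (inord (minn (c + is_leaf l) k), inord (minn (r + is_root l) 2),
   [|| bad, is_leaf l && x | is_root l && ~~ x], unhit,
   [ffun b => if b == a then (l, x, false) else f b]).

Definition check_arc (a b : 'I_K) (s : check_state) : check_state :=
  let: (c, r, bad, unhit, f) := s in
  (c, r, bad || [&& (f a).1.2, ~~ (f b).1.2 & ~~ is_leaf (f b).1.1], unhit,
   [ffun d => if d == b then ((f b).1, (f b).2 || (f a).1.2) else f d]).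

Definition check_forget (a : 'I_K) (s : check_state) : check_state :=
  let: (c, r, bad, unhit, f) := s in
  (c, r, bad, unhit || (is_leaf (f a).1.1 && ~~ (f a).2),
   [ffun b => if b == a then empty_slot else f b]).

Definition check_accept (s : check_state) : bool :=
  let: (c, r, bad, unhit, _) := s in
  [&& c == k :> nat, r == 1 :> nat & bad || ~~ unhit].

(** The outer set ranges over labellings, each inner set over the choices of X for one labelling: an
    existential quantifier over a universal one. *)
Definition auto_state := {set {set check_state}}.

(** The label is chosen once for a whole inner set, as a labelling must not depend on X; membership
    in X branches inside it. *)
Definition auto_new (a : 'I_K) (S : auto_state) : auto_state :=
  [set [set check_new a l x q | q in (s : {set check_state}), x in {: bool}] | s in S, l in {: label}].
Definition auto_arc (a b : 'I_K) (S : auto_state) : auto_state :=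
  [set [set check_arc a b q | q in (s : {set check_state})] | s in S].
Definition auto_forget (a : 'I_K) (S : auto_state) : auto_state :=
  [set [set check_forget a q | q in (s : {set check_state})] | s in S].
Definition auto_accept (S : auto_state) : bool :=
  [exists s in S, [forall q in (s : {set check_state}), check_accept q]].

(** * What the automaton states mean *)

Section Semantics.
Variable V : finType.
Implicit Types (N : {set V}) (P : {set V * V}) (sl : V -> option 'I_K).
Implicit Types (lam : {ffun V -> label}) (chi : {ffun V -> bool}).

Definition hit P chi v := [exists u, ((u, v) \in P) && chi u].

(* N is the set of vertices seen so far, P the set of arcs read so far, and
   [sl] assigns their slots to the vertices that are not discarded. *)
Definition check_sem N P sl lam chi : check_state :=
  (inord (minn #|[set v in N | is_leaf (lam v)]| k),
   inord (minn #|[set v in N | is_root (lam v)]| 2),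
   [exists v in N, (is_leaf (lam v) && chi v) || (is_root (lam v) && ~~ chi v)]
   || [exists a in P, [&& chi a.1, ~~ chi a.2 & ~~ is_leaf (lam a.2)]],
   [exists v in N, [&& sl v == None, is_leaf (lam v) & ~~ hit P chi v]],
   [ffun a => if [pick v | sl v == Some a] is Some v
              then (lam v, chi v, hit P chi v) else empty_slot]).

Definition auto_sem N P sl : auto_state :=
  [set [set check_sem N P sl lam chi | chi in {: {ffun V -> bool}}]
     | lam in {: {ffun V -> label}}].

Definition upds sl v o : V -> option 'I_K := fun u => if u == v then o else sl u.

Record slots_wf N P sl : Prop := SlotsWf {
  wf_slot : forall v a, sl v = Some a -> v \in N;
  wf_arc : forall u v, (u, v) \in P -> u \in N /\ v \in N;
  wf_inj : forall u v a, sl u = Some a -> sl v = Some a -> u = v }.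

Lemma pick_slot sl v a : (forall u, sl u = Some a -> u = v) ->
  sl v = Some a -> [pick u | sl u == Some a] = Some v.
Proof.
move=> inj h; case: pickP => [u /eqP/inj->//|/(_ v)]; by rewrite h eqxx.
Qed.

Lemma card_set_new N (p : pred V) v : v \notin N ->
  #|[set x in v |: N | p x]| = #|[set x in N | p x]| + p v.
Proof.
move=> vN; case pv: (p v); rewrite ?addn0 ?addn1.
  rewrite -[RHS]/(1 + _) (_ : [set x in v |: N | p x] = v |: [set x in N | p x]).
    by rewrite cardsU1 inE (negbTE vN).
  apply/setP => x; rewrite !inE; case: eqP => // ->; by rewrite pv.
apply: eq_card => x; rewrite !inE; case: eqP => // ->; by rewrite pv (negbTE vN).
Qed.

Lemma exists_setU1 (T : finType) (N : {set T}) (p : pred T) v :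
  [exists x in v |: N, p x] = [exists x in N, p x] || p v.
Proof.
apply/existsP/orP => [[x /andP[]]|[/existsP[x /andP[xN px]]|pv]].
- rewrite !inE => /orP[/eqP->|xN] px; first by right.
  by left; apply/existsP; exists x; rewrite xN.
- by exists x; rewrite !inE xN orbT.
- by exists v; rewrite !inE eqxx.
Qed.

Lemma minn_addl m n c : minn (minn m c + n) c = minn (m + n) c.
Proof. lia. Qed.

Lemma check_sem_new N P sl lam chi v a : slots_wf N P sl ->
  v \notin N -> (forall u, sl u <> Some a) ->
  check_sem (v |: N) P (upds sl v (Some a)) lam chi =
  check_new a (lam v) (chi v) (check_sem N P sl lam chi).
Proof.
move=> [ws wa wi] vN fa; rewrite /check_sem /check_new.
have nh : hit P chi v = false.
  by rewrite /hit; apply/existsP => -[u /andP[/wa[_ h]]]; rewrite h in vN.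
congr (_, _, _, _, _).
- by rewrite card_set_new // inordK ?ltnS ?geq_minr // minn_addl.
- by rewrite card_set_new // inordK ?ltnS ?geq_minr // minn_addl.
- by rewrite exists_setU1 -orbA [X in _ || X]orbC orbA.
- rewrite exists_setU1 /upds eqxx /= orbF; apply: eq_existsb => u.
  by case: (u =P v) => // ->; rewrite (negbTE vN).
apply/ffunP => b; rewrite !ffunE; case: (eqVneq b a) => [->|ba].
  rewrite (@pick_slot _ v) ?nh //; last by rewrite /upds eqxx.
  by move=> u; rewrite /upds; case: (u =P v) => // _ /fa.
congr (if _ is Some v then _ else _); apply: eq_pick => u; rewrite /upds.
case: (u =P v) => // ->; apply/idP/idP => /eqP; first by case=> e; rewrite e eqxx in ba.
by move/ws => h; rewrite h in vN.
Qed.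

Lemma check_sem_arc N P sl lam chi u v a b : slots_wf N P sl ->
  sl u = Some a -> sl v = Some b ->
  check_sem N ((u, v) |: P) sl lam chi =
  check_arc a b (check_sem N P sl lam chi).
Proof.
move=> [ws wa wi] ua vb; rewrite /check_sem /check_arc.
have hitE x : hit ((u, v) |: P) chi x = hit P chi x || ((x == v) && chi u).
  rewrite /hit; apply/existsP/orP => [[y /andP[]]|[/existsP[y /andP[yP hy]]|/andP[/eqP-> hu]]].
  - rewrite !inE => /orP[/eqP[-> ->]|yx] hy; first by right; rewrite eqxx.
    by left; apply/existsP; exists y; rewrite yx.
  - by exists y; rewrite !inE yP orbT.
  - by exists u; rewrite !inE eqxx.
have pu : [pick x | sl x == Some a] = Some u.
  by apply: pick_slot => // x xa; apply: wi xa ua.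
have pv : [pick x | sl x == Some b] = Some v.
  by apply: pick_slot => // x xa; apply: wi xa vb.
congr (_, _, _, _, _).
- by rewrite !ffunE pu pv /= exists_setU1 /= orbA.
- apply: eq_existsb => x; rewrite hitE; case: (x =P v) => [->|_]; last by rewrite orbF.
  by rewrite vb /= !andbF.
apply/ffunP => d; rewrite !ffunE pu pv; case: (eqVneq d b) => [->|db].
  by rewrite pv hitE eqxx.
case: pickP => // x /eqP xd; rewrite hitE; case: eqP => [xv|]; last by rewrite orbF.
by move: db; rewrite xv vb in xd; case: xd => ->; rewrite eqxx.
Qed.

Lemma check_sem_forget N P sl lam chi v a : slots_wf N P sl ->
  sl v = Some a ->
  check_sem N P (upds sl v None) lam chi =
  check_forget a (check_sem N P sl lam chi).
Proof.
move=> [ws wa wi] va; rewrite /check_sem /check_forget.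
have pv : [pick x | sl x == Some a] = Some v.
  by apply: pick_slot => // x xa; apply: wi xa va.
congr (_, _, _, _, _).
- rewrite !ffunE pv /=; apply/existsP/orP.
    case=> x /and4P[xN]; rewrite /upds; case: (x =P v) => [-> _ h1 h2|_ h0 h1 h2].
      by right; rewrite h1.
    by left; apply/existsP; exists x; rewrite xN h0 h1.
  case=> [/existsP[x /and4P[xN h0 h1 h2]]|/andP[h1 h2]].
    by exists x; rewrite xN h1 h2 /upds; case: (x =P v); rewrite ?h0.
  by exists v; rewrite (ws _ _ va) /upds eqxx h1.
apply/ffunP => b; rewrite !ffunE; case: (eqVneq b a) => [->|ba].
  case: pickP => // x; rewrite /upds; case: (x =P v) => // xv /eqP xa.
  by case: xv; apply: wi xa va.
congr (if _ is Some v then _ else _); apply: eq_pick => x; rewrite /upds.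
case: (x =P v) => // ->; rewrite va; apply/esym/negP => /eqP[e].
by rewrite e eqxx in ba.
Qed.

(** This allows a labelling and a set X to be redefined at a vertex that is about to be read. *)
Lemma check_sem_ext N P sl lam lam' chi chi' : slots_wf N P sl ->
  {in N, lam =1 lam'} -> {in N, chi =1 chi'} ->
  check_sem N P sl lam chi = check_sem N P sl lam' chi'.
Proof.
move=> [ws wa wi] el ec; rewrite /check_sem.
have hitE v : hit P chi v = hit P chi' v.
  apply: eq_existsb => u; case uv: (_ \in P) => //=.
  by have [uN _] := wa _ _ uv; rewrite ec.
congr (_, _, _, _, _).
- by congr (inord (minn _ _)); apply: eq_card => v; rewrite !inE; case: (boolP (v \in N)) => //= /el->.
- by congr (inord (minn _ _)); apply: eq_card => v; rewrite !inE; case: (boolP (v \in N)) => //= /el->.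
- congr (_ || _); apply: eq_existsb => v.
    by case: (boolP (v \in N)) => //= vN; rewrite el // ec.
  case: v => u v /=; case uv: (_ \in P) => //=.
  by have [uN vN] := wa _ _ uv; rewrite !ec // el.
- apply: eq_existsb => v; rewrite hitE.
  by case: (boolP (v \in N)) => //= vN; rewrite el.
apply/ffunP => a; rewrite !ffunE; case: pickP => // v /eqP/ws vN.
by rewrite el // ec // hitE.
Qed.

Definition updf (T : Type) (f : {ffun V -> T}) v x : {ffun V -> T} :=
  [ffun u => if u == v then x else f u].

Lemma auto_sem_new N P sl v a : slots_wf N P sl ->
  v \notin N -> (forall u, sl u <> Some a) ->
  auto_sem (v |: N) P (upds sl v (Some a)) = auto_new a (auto_sem N P sl).
Proof.
move=> wf vN fa.
have updN (T : Type) (f : {ffun V -> T}) x : {in N, updf f v x =1 f}.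
  by move=> u uN; rewrite ffunE; case: eqP => // e; rewrite -e uN in vN.
have E lam : [set check_sem (v |: N) P (upds sl v (Some a)) lam chi | chi in {: {ffun V -> bool}}]
   = [set check_new a (lam v) x q | q in [set check_sem N P sl lam chi | chi in {: {ffun V -> bool}}], x in {: bool}].
  apply/setP => q; apply/imsetP/imset2P.
    case=> chi _ ->; exists (check_sem N P sl lam chi) (chi v) => //.
      by apply/imsetP; exists chi.
    exact: check_sem_new.
  case=> _ x /imsetP[chi _ ->] _ ->; exists (updf chi v x) => //.
  rewrite check_sem_new // !ffunE eqxx; congr check_new.
  by apply: check_sem_ext => // u uN; rewrite updN.
apply/setP => s; apply/imsetP/imset2P.
  case=> lam _ ->; exists [set check_sem N P sl lam chi | chi in {: {ffun V -> bool}}] (lam v) => //.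
  by apply/imsetP; exists lam.
case=> _ l /imsetP[lam _ ->] _ ->; exists (updf lam v l) => //.
rewrite E ffunE eqxx; congr (imset2 _ _ _).
have -> : [set check_sem N P sl lam chi | chi in {: {ffun V -> bool}}]
   = [set check_sem N P sl (updf lam v l) chi | chi in {: {ffun V -> bool}}].
  by apply: eq_imset => chi; apply: check_sem_ext => // u uN; rewrite updN.
by [].
Qed.

Lemma auto_sem_arc N P sl u v a b : slots_wf N P sl ->
  sl u = Some a -> sl v = Some b ->
  auto_sem N ((u, v) |: P) sl = auto_arc a b (auto_sem N P sl).
Proof.
move=> wf ua vb; rewrite /auto_sem /auto_arc -imset_comp.
apply: eq_imset => lam /=; rewrite -imset_comp; apply: eq_imset => chi /=.
exact: check_sem_arc.
Qed.

Lemma auto_sem_forget N P sl v a : slots_wf N P sl -> sl v = Some a ->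
  auto_sem N P (upds sl v None) = auto_forget a (auto_sem N P sl).
Proof.
move=> wf va; rewrite /auto_sem /auto_forget -imset_comp.
apply: eq_imset => lam /=; rewrite -imset_comp; apply: eq_imset => chi /=.
exact: check_sem_forget.
Qed.

Lemma auto_sem_accept (D : digraph V) sl : (forall v, sl v = None) ->
  auto_accept (auto_sem [set: V] (arcs D) sl) <-> leafy k D.
Proof.
move=> sl0.
pose ok lam := forall chi, check_accept (check_sem [set: V] (arcs D) sl lam chi).
have -> : auto_accept (auto_sem [set: V] (arcs D) sl) <-> exists lam, ok lam.
  split=> [/existsP[s /andP[/imsetP[lam _ ->] /forallP h]]|[lam h]].
    by exists lam => chi; have := h (check_sem [set: V] (arcs D) sl lam chi); rewrite imset_f.
  apply/existsP; exists [set check_sem [set: V] (arcs D) sl lam chi | chi in {: {ffun V -> bool}}].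
  rewrite imset_f //=; apply/forallP => q; apply/implyP => /imsetP[chi _ ->]; exact: h.
have acc lam chi : check_accept (check_sem [set: V] (arcs D) sl lam chi) =
   [&& k <= #|[set v | is_leaf (lam v)]|, #|[set v | is_root (lam v)]| == 1 &
    [exists v, (is_leaf (lam v) && chi v) || (is_root (lam v) && ~~ chi v)]
   || [exists a in arcs D, [&& chi a.1, ~~ chi a.2 & ~~ is_leaf (lam a.2)]]
   || [forall v, is_leaf (lam v) ==> hit (arcs D) chi v]].
  rewrite /check_accept /check_sem !inordK ?ltnS ?geq_minr //.
  rewrite (_ : [set v in [set: V] | is_leaf (lam v)] = [set v | is_leaf (lam v)]); last by apply/setP => v; rewrite !inE.
  rewrite (_ : [set v in [set: V] | is_root (lam v)] = [set v | is_root (lam v)]); last by apply/setP => v; rewrite !inE.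
  congr [&& _, _ & _]; [lia|lia|].
  congr (_ || _ || _); first by apply: eq_existsb => v; rewrite inE.
  rewrite negb_exists; apply: eq_forallb => v.
  by rewrite inE sl0 eqxx /= negb_and negbK implybE.
split=> [[lam ok_lam]|[r [L [rL kL hL]]]].
  (* The numbers of leaves and roots do not depend on [chi], so any choice reveals them. *)
  have := ok_lam [ffun=> true]; rewrite acc => /and3P[kL /cards1P[r rE] _].
  pose L := [set v | is_leaf (lam v)].
  have rr : is_root (lam r) by have : r \in [set r] by [rewrite inE]; rewrite -rE inE.
  have rL : r \notin L by rewrite inE; move: rr; rewrite /is_root /is_leaf => /eqP->.
  exists r, L; split=> // l lL.
  (* The set that [r] reaches outside [L] is admissible, so it must send an arc to every leaf. *)
  have := ok_lam [ffun x => connect (restr D (~: L)) r x]; rewrite acc => /and3P[_ _].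
  have rC : r \in ~: L by rewrite in_setC.
  case/orP=> [/orP[/existsP[v]|/existsP[[u v]]]|/forallP/(_ l)].
  - rewrite ffunE => /orP[/andP[lv /(connect_restr rC)]|/andP[rv]].
      by rewrite !inE lv.
    have -> : v = r by apply/set1P; rewrite -rE inE.
    by rewrite connect0.
  - rewrite /= !ffunE => /and4P[uv ru nv lv]; case/negP: nv.
    apply: connect_trans (ru) _; apply: connect1; rewrite /restr uv /=.
    by rewrite !inE lv andbT; have := connect_restr rC ru; rewrite !inE.
  rewrite inE in lL; rewrite lL /= /hit => /existsP[x]; rewrite ffunE => /andP[h1 h2].
  by exists x.
exists [ffun v => if v \in L then Some true else if v == r then Some false else None] => chi.
set lam := finfun _.
have leafE v : is_leaf (lam v) = (v \in L).
  by rewrite ffunE; do 2?case: ifP.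
have rootE v : is_root (lam v) = (v == r).
  rewrite ffunE; case: ifP => vL; last by case: ifP.
  by case: eqP => // e; rewrite -e vL in rL.
rewrite acc; apply/and3P; split.
- by rewrite (_ : [set v | _] = L) //; apply/setP => v; rewrite inE leafE.
- by rewrite (_ : [set v | _] = [set r]) ?cards1 //; apply/setP => v; rewrite !inE rootE.
rewrite -implyNb negb_or; apply/implyP => /andP[/existsPn bad1 /existsPn bad2].
apply/forallP => l; apply/implyP; rewrite leafE => lL.
have [x rx xl] := hL l lL; rewrite /hit; apply/existsP; exists x; rewrite xl /=.
have cr : chi r by apply/negPn/negP => h; have := bad1 r; rewrite rootE eqxx h orbT.
(* An admissible set contains [r] and cannot be left along a path that avoids [L], so it contains
   [x]. *)
move: cr; case/connectP: rx => p + ->.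
elim: p (r) => [|y p IH] z //= /andP[/and3P[zy _ yL] yp] cz; apply: IH yp _.
rewrite inE in yL; apply/negPn/negP => ny.
by have := bad2 (z, y); rewrite zy /= cz ny leafE yL.
Qed.
End Semantics.
End Automaton.

(** * The program *)

Declare Scope stm_scope.
Delimit Scope stm_scope with stm.
Bind Scope stm_scope with stm.
Notation "b1 ;; b2" := (Seq b1 b2)
  (at level 60, right associativity) : stm_scope.

(** Modes 0 to 4 are: reading the sizes, building the adjacency lists, searching, turning to the
    next vertex of the sweep, scanning its out-arcs. [rX] holds the coded sweep state, [rA] and [rB]
    one plus the slots of tail and head, [rT] is scratch. *)
Local Notation rAns := 0 (only parsing).
Local Notation rHalt := 1 (only parsing).
Local Notation rMode := 2 (only parsing).
Local Notation rN := 3 (only parsing).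
Local Notation rM := 4 (only parsing).
Local Notation rP := 5 (only parsing).
Local Notation rE := 6 (only parsing).
Local Notation rU := 7 (only parsing).
Local Notation rW := 8 (only parsing).
Local Notation rV := 9 (only parsing).
Local Notation rS := 10 (only parsing).
Local Notation rQh := 11 (only parsing).
Local Notation rQt := 12 (only parsing).
Local Notation rMark := 13 (only parsing).
Local Notation rX := 14 (only parsing).
Local Notation rA := 15 (only parsing).
Local Notation rB := 16 (only parsing).
Local Notation rT := 17 (only parsing).

(* Arc e has head HD e, and NX e is the next arc with the same tail, starting
   with H u for the tail u; Q is the queue, from Qh to Qt; SLOT v is one plus the
   slot of v, or 0 if v has none. *)
Local Notation aHD := (@Ordinal 8 0 isT) (only parsing).
Local Notation aNX := (@Ordinal 8 1 isT) (only parsing).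
Local Notation aH := (@Ordinal 8 2 isT) (only parsing).
Local Notation aVIS := (@Ordinal 8 3 isT) (only parsing).
Local Notation aQ := (@Ordinal 8 4 isT) (only parsing).
Local Notation aLAST := (@Ordinal 8 5 isT) (only parsing).
Local Notation aSLOT := (@Ordinal 8 6 isT) (only parsing).

(** A table lookup by comparison with constants. The tables below have a size that depends on [k]
    only. *)
Fixpoint dispatch x i n (b : nat -> stm) : stm :=
  if n is n'.+1 then IfLtc x i.+1 (b i) (dispatch x i.+1 n' b) else Skip.

Lemma ex_dispatch w x i n b s : i <= rg s x < i + n ->
  ex w (dispatch x i n b) s = ex w (b (rg s x)) s.
Proof.
elim: n i => [|n IH] i /= hx; first by lia.
case: ltnP => h; last by apply: IH; lia.
by have -> : rg s x = i by lia.
Qed.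

Section Program.
Variable k : nat.

(* At most k - 1 heads of arcs leave a prefix of the search order, and at most
   (k - 1)^2 leave a suffix, unless there are at least k leaves. *)
Definition K := (k * k + k).+2.

(** The set of occupied slots is part of the state, so that a free slot is also found by table
    lookup. *)
Definition sweep_state : Type := (auto_state k K * {set 'I_K})%type.
Definition code (x : sweep_state) : nat := enum_rank x.
Definition decode (i : nat) : sweep_state := nth (set0, set0) (enum {: sweep_state}) i.
Definition codes := #|{: sweep_state}|.

Lemma codeK : cancel code decode. Proof. by move=> x; rewrite /decode nth_enum_rank. Qed.
Lemma code_lt x : code x < codes. Proof. exact: ltn_ord. Qed.

Definition sweep_new (x : sweep_state) (a : nat) : sweep_state :=
  if insub a is Some a then (auto_new a x.1, a |: x.2) else x.
Definition sweep_arc (x : sweep_state) (a b : nat) : sweep_state :=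
  if (insub a, insub b) is (Some a, Some b) then (auto_arc a b x.1, x.2) else x.
Definition sweep_forget (x : sweep_state) (a : nat) : sweep_state :=
  if insub a is Some a then (auto_forget a x.1, x.2 :\ a) else x.
Definition sweep_free (x : sweep_state) : nat :=
  if [pick a | a \notin x.2] is Some a then val a else K.
Definition sweep_accept (x : sweep_state) : bool := (k == 1) || auto_accept x.1.

Definition check_state0 : check_state k K :=
  (inord 0, inord 0, false, false, [ffun=> empty_slot]).
Definition sweep_state0 : sweep_state := ([set [set check_state0]], set0).

Definition free_code :=
  dispatch rX 0 codes (fun i => Cst rT (sweep_free (decode i))).
Definition new_code :=
  dispatch rX 0 codes (fun i =>
  dispatch rT 0 K (fun a => Cst rX (code (sweep_new (decode i) a)))).
Definition arc_code :=
  dispatch rX 0 codes (fun i =>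
  dispatch rA 1 K (fun a =>
  dispatch rB 1 K (fun b => Cst rX (code (sweep_arc (decode i) a.-1 b.-1))))).
Definition forget_code r :=
  dispatch rX 0 codes (fun i =>
  dispatch r 1 K (fun a => Cst rX (code (sweep_forget (decode i) a.-1)))).
Definition accept_code :=
  dispatch rX 0 codes (fun i => Cst rAns (sweep_accept (decode i))).

Lemma ex_free w s x : rg s rX = code x ->
  ex w free_code s = State (upd (rg s) rT (sweep_free x)) (ar s).
Proof.
by move=> h; rewrite /free_code ex_dispatch h ?code_lt //= codeK.
Qed.

Lemma ex_new w s x (a : 'I_K) : rg s rX = code x -> rg s rT = a ->
  ex w new_code s = State (upd (rg s) rX (code (auto_new a x.1, a |: x.2))) (ar s).
Proof.
move=> h h'; rewrite /new_code ex_dispatch h ?code_lt // ex_dispatch h' ?ltn_ord //=.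
by rewrite codeK /sweep_new valK.
Qed.

Lemma ex_arc w s x (a b : 'I_K) :
  rg s rX = code x -> rg s rA = a.+1 -> rg s rB = b.+1 ->
  ex w arc_code s = State (upd (rg s) rX (code (auto_arc a b x.1, x.2))) (ar s).
Proof.
move=> h ha hb; rewrite /arc_code ex_dispatch h ?code_lt //.
rewrite ex_dispatch; last by rewrite ha; have := ltn_ord a; lia.
rewrite ex_dispatch; last by rewrite hb; have := ltn_ord b; lia.
by rewrite ha hb /= codeK /sweep_arc !valK.
Qed.

Lemma ex_forget w s x r (a : 'I_K) : rg s rX = code x -> rg s r = a.+1 ->
  ex w (forget_code r) s =
  State (upd (rg s) rX (code (auto_forget a x.1, x.2 :\ a))) (ar s).
Proof.
move=> h ha; rewrite /forget_code ex_dispatch h ?code_lt //.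
rewrite ex_dispatch; last by rewrite ha; have := ltn_ord a; lia.
by rewrite ha /= codeK /sweep_forget valK.
Qed.

Lemma ex_accept w s x : rg s rX = code x ->
  ex w accept_code s = State (upd (rg s) rAns (sweep_accept x)) (ar s).
Proof. by move=> h; rewrite /accept_code ex_dispatch h ?code_lt //= codeK. Qed.

Local Open Scope stm_scope.

(** [rP] starts at 0, the address of the number of vertices. Without vertices the answer stays 0,
    which is right as [k] is positive. *)
Definition init_code :=
  Inp rN rP ;; Cst rP 1 ;; Inp rM rP ;; Cst rP 2 ;; Cst rMode 1 ;;
  IfLtc rN 1 (Cst rHalt 1) Skip.

(* Arcs are numbered from 1, so that 0 can end the adjacency lists. *)
Definition build_code :=
  IfLt rE rM
    (Inp rU rP ;; Inc rP rP ;; Inp rW rP ;; Inc rP rP ;; Inc rE rE ;;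
     St aHD rE rW ;; Ld aH rT rU ;; St aNX rE rT ;; St aH rU rE)
    (Cst rE 0 ;; Cst rMark 1 ;; Cst rMode 2).

Definition push_code x := St aVIS x rMark ;; St aQ rQt x ;; Inc rQt rQt.

(* With mark 1, searches are started until all vertices are visited; only the
   start S of the last one can be a root. With mark 2, a single search is
   started at S, and LAST v ends up being one plus the position in the queue
   of the last vertex among v and its in-neighbours. *)
Definition search_code :=
  IfLtc rE 1
    (IfLt rQh rQt
       (Ld aQ rU rQh ;; Inc rQh rQh ;; Ld aH rE rU ;; St aLAST rU rQh)
       (IfLtc rMark 2
          (IfLt rV rN
             (Ld aVIS rT rV ;; IfLtc rT 1 (Mov rS rV ;; push_code rV) Skip ;;
              Inc rV rV)
             (Cst rMark 2 ;; Cst rQh 0 ;; Cst rQt 0 ;; push_code rS))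
          (IfLt rQt rN (Cst rHalt 1)
             (Cst rMode 3 ;; Cst rQh 0 ;; Cst rX (code sweep_state0)))))
    (Ld aHD rW rE ;; Ld aNX rE rE ;; St aLAST rW rQh ;; Ld aVIS rT rW ;;
     IfLt rT rMark (push_code rW) Skip).

Definition alloc_code x :=
  free_code ;;
  IfLtc rT K (new_code ;; Inc rT rT ;; St aSLOT x rT)
    (Cst rAns 1 ;; Cst rHalt 1).

(** LAST is one plus a position, and so is [rQh] with respect to the vertex being scanned; equality
    means that this vertex is the last to touch the one in [x]. *)
Definition discard_code x r :=
  Ld aLAST rT x ;;
  IfLt rQh rT Skip (forget_code r ;; Cst rT 0 ;; St aSLOT x rT).

(** A pass that allocates a slot does not advance: the next pass meets the same vertex, now with a
    slot. The same holds in [scan_code]. *)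
Definition pop_code :=
  IfLt rQh rN
    (Ld aQ rU rQh ;; Ld aSLOT rA rU ;;
     IfLtc rA 1 (alloc_code rU)
       (Inc rQh rQh ;; Ld aH rE rU ;; Cst rMode 4))
    (accept_code ;; Cst rHalt 1).

Definition scan_code :=
  IfLtc rE 1
    (discard_code rU rA ;; Cst rMode 3)
    (Ld aHD rW rE ;; Ld aSLOT rB rW ;;
     IfLtc rB 1 (alloc_code rW)
       (Ld aNX rE rE ;; arc_code ;; discard_code rW rB)).

Definition body :=
  IfLtc rMode 1 init_code (IfLtc rMode 2 build_code (IfLtc rMode 3 search_code
    (IfLtc rMode 4 pop_code scan_code))).

Lemma ex_body w s : ex w body s =
  match rg s rMode with
  | 0 => ex w init_code s | 1 => ex w build_code s | 2 => ex w search_code s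
  | 3 => ex w pop_code s | _ => ex w scan_code s
  end.
Proof. by rewrite /body /=; case: (rg s 2) => [|[|[|[|i]]]]. Qed.

End Program.

Arguments free_code : simpl never.
Arguments new_code : simpl never.
Arguments arc_code : simpl never.
Arguments forget_code : simpl never.
Arguments accept_code : simpl never.
Arguments alloc_code : simpl never.
Arguments discard_code : simpl never.

(** * The input and its adjacency lists *)

Section Input.
Variables (n : nat) (al : seq ('I_n * 'I_n)).
Hypothesis n0 : 0 < n.
Let x0 : 'I_n := Ordinal n0.
Let m := size al.
Let w := nth 0 (encode al).

Lemma size_encode : size (encode al) = 2 + 2 * m.
Proof.
rewrite /encode /= /m; congr _.+2; elim: al => //= a l IH.
by rewrite IH mulnS.
Qed.

Lemma encode_arc i : i < m ->
  w (2 + 2 * i) = (nth (x0, x0) al i).1 /\ w (3 + 2 * i) = (nth (x0, x0) al i).2.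
Proof.
rewrite /w /encode /m.
suff H l j : j < size l -> let f := flatten [seq [:: val a.1; val a.2] | a <- l] in
    nth 0 f (2 * j) = (nth (x0, x0) l j).1 /\ nth 0 f (2 * j).+1 = (nth (x0, x0) l j).2.
  by move=> hi; apply: H.
elim: l j => // a l IH [|j] hj //; rewrite mulnS; exact: IH.
Qed.

Lemma encode_le i : w i <= n + m.
Proof.
rewrite /w /encode; case: i => [|[|i]] /=; rewrite ?leq_addr ?leq_addl //.
apply: (@leq_trans n); last exact: leq_addr.
elim: al i => [|a l IH] [|[|i]] //=; exact: ltnW.
Qed.

(** Reversed, because [build_code] puts each arc in front of the list of its tail. *)
Definition outl (a : seq ('I_n * 'I_n)) (u : 'I_n) : seq 'I_n :=
  [seq x.2 | x <- rev a & x.1 == u].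

Lemma outl_rcons a x u :
  outl (rcons a x) u = if x.1 == u then x.2 :: outl a u else outl a u.
Proof. by rewrite /outl rev_rcons /=; case: ifP. Qed.

Lemma sum_outl : \sum_u size (outl al u) = m.
Proof.
rewrite /m; elim/last_ind: al => [|a x IH].
  by rewrite big1 // => u.
rewrite size_rcons -IH (bigD1 x.1) //= [in RHS](bigD1 x.1) //= outl_rcons eqxx /=.
congr _.+1; congr (_ + _); apply: eq_bigr => u hu.
by rewrite outl_rcons eq_sym (negbTE hu).
Qed.

(** The bound [E] on the arc numbers shows that writing the entries of arc [E.+1] leaves existing
    lists intact. *)
Fixpoint chain (hd nx : nat -> nat) E e (l : seq 'I_n) : Prop :=
  if l is v :: l' then [/\ 0 < e <= E, hd e = v & chain hd nx E (nx e) l']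
  else e = 0.

Lemma chain_ext hd nx hd' nx' E E' e l :
  (forall i, i <= E -> hd i = hd' i) -> (forall i, i <= E -> nx i = nx' i) ->
  E <= E' -> chain hd nx E e l -> chain hd' nx' E' e l.
Proof.
move=> hh hn le; elim: l e => [|v l IH] e //= [/andP[e0 eE] hv hc].
split; [by rewrite e0 (leq_trans eE le)|by rewrite -hh|by rewrite -hn //; apply: IH].
Qed.

Definition adjacency (A : nat -> nat -> nat) a :=
  forall u : 'I_n, chain (A 0) (A 1) (size a) (A 2 u) (outl a u).

Record build_inv i s : Prop := BuildInv {
  bi_le : i <= m;
  bi_mode : rg s rMode = 1;
  bi_halt : rg s rHalt = 0;
  bi_ans : rg s rAns = 0;
  bi_n : rg s rN = n;
  bi_m : rg s rM = m;
  bi_p : rg s rP = 2 + 2 * i;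
  bi_e : rg s rE = i;
  bi_v : rg s rV = 0;
  bi_qh : rg s rQh = 0;
  bi_qt : rg s rQt = 0;
  bi_adj : adjacency (ar s) (take i al);
  bi_vis : forall j, ar s 3 j = 0;
  bi_slot : forall j, ar s 6 j = 0 }.

Lemma build_init : build_inv 0 (ex w init_code state0).
Proof.
have w0 : w 0 = n by [].
by rewrite /= /upd /= w0 ltnNge n0 /=; split=> //=; rewrite ?take0.
Qed.

Lemma build_step i s : build_inv i s -> i < m ->
  build_inv i.+1 (ex w build_code s).
Proof.
case=> h1 h2 h3 h4 h5 h6 h7 h8 h9 h10 h11 h12 h13 h14 im.
have [wu wv] := encode_arc im; set a := nth _ _ _ in wu wv.
rewrite /= /upd /upd2 /= h8 h6 im h7 wu.
have -> : w (2 + 2 * i).+1 = a.2 by rewrite -wv; congr w; lia.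
split=> //=; first by lia.
have ta : take i.+1 al = rcons (take i al) a by rewrite (take_nth (x0, x0)).
move=> u; rewrite ta outl_rcons size_rcons size_takel //=.
have h12' := h12 u; rewrite size_takel // in h12'.
have fr (l : seq 'I_n) e : chain (ar s 0) (ar s 1) i e l ->
    chain (fun j => if j == i.+1 then a.2 : nat else ar s 0 j)
          (fun j => if j == i.+1 then ar s 2 a.1 else ar s 1 j) i.+1 e l.
  by apply: chain_ext => // j ji; rewrite ifN //; lia.
rewrite eq_sym -val_eqE /=; case: eqP => [au|au]; last exact: fr.
rewrite /= eqxx leqnn; split=> //; apply: fr.
by have := h12 a.1; rewrite size_takel // -(val_inj au).
Qed.

Variable D : digraph 'I_n.
Hypothesis al_perm : perm_eq al (enum (arcs D)).

Lemma mem_al a : (a \in al) = (a \in arcs D).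
Proof. by rewrite (perm_mem al_perm) mem_enum. Qed.

Lemma al_uniq : uniq al.
Proof. by rewrite (perm_uniq al_perm) enum_uniq. Qed.

Lemma mem_outl u v : (v \in outl al u) = ((u, v) \in arcs D).
Proof.
rewrite -mem_al; apply/mapP/idP => [[[a b]]|uv].
  by rewrite mem_filter mem_rev => /andP[/eqP /= ->] ? ->.
by exists (u, v) => //; rewrite mem_filter mem_rev eqxx.
Qed.

Lemma outl_uniq u : uniq (outl al u).
Proof.
rewrite map_inj_in_uniq ?filter_uniq ?rev_uniq ?al_uniq //.
move=> [a b] [c d]; rewrite !mem_filter => /andP[/eqP /= -> _] /andP[/eqP /= -> _] /=.
by move=> ->.
Qed.
End Input.

(** * The search phase *)

Section Search.
Variables (k n : nat) (D : digraph 'I_n) (al : seq ('I_n * 'I_n)).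
Hypothesis al_perm : perm_eq al (enum (arcs D)).
Variables (x0 : 'I_n) (w : nat -> nat).
Let m := size al.

(** A potential: each vertex still to be popped pays for scanning its out-arcs, and [c] for
    itself. *)
Definition unpopped c h (q : seq 'I_n) :=
  \sum_(v | v \notin take h q) (size (outl al v) + c).

Lemma unpopped_rcons c h q v : h <= size q ->
  unpopped c h (rcons q v) = unpopped c h q.
Proof. by move=> h1; rewrite /unpopped -cats1 takel_cat. Qed.

Lemma unpoppedS c h q : uniq q -> h < size q ->
  unpopped c h q = size (outl al (nth x0 q h)) + c + unpopped c h.+1 q.
Proof.
move=> uq hq; rewrite /unpopped (bigD1 (nth x0 q h)) /=.
  congr (_ + _); apply: eq_bigl => v; rewrite (take_nth x0 hq) mem_rcons inE negb_or.
  by rewrite andbC.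
have := take_uniq h.+1 uq; rewrite (take_nth x0 hq) rcons_uniq.
by case/andP.
Qed.

Lemma unpopped0 c q : unpopped c 0 q = m + n * c.
Proof. by rewrite /unpopped take0 big_split /= sum_outl sum_nat_const card_ord. Qed.

(** The part of [touches] already recorded in LAST: the arcs from the vertex popped last to the
    vertices in [l] are still pending. *)
Definition seen (q l : seq 'I_n) h i v :=
  (i < h) && ((nth x0 q i == v) ||
    ((nth x0 q i, v) \in arcs D) && ~~ ((i.+1 == h) && (v \in l))).

(* q is the queue, l the part of the current adjacency list that remains to be
   scanned, and c0 the position in q of the start of the current search. *)
Record search_inv c0 (q l : seq 'I_n) s : Prop := SearchInv {
  si_mode : rg s rMode = 2;
  si_halt : rg s rHalt = 0;
  si_ans : rg s rAns = 0;
  si_n : rg s rN = n;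
  si_adj : adjacency (ar s) al;
  si_slot : forall j, ar s 6 j = 0;
  si_qt : rg s rQt = size q;
  si_qh : rg s rQh <= size q;
  si_q : forall i, i < size q -> ar s 4 i = nth x0 q i;
  si_uniq : uniq q;
  si_vis : forall v : 'I_n, (ar s 3 v < rg s rMark) = (v \notin q);
  si_vis_le : forall v : 'I_n, ar s 3 v <= rg s rMark;
  si_l : chain (ar s 0) (ar s 1) m (rg s rE) l;
  si_luniq : uniq l;
  si_larc : forall v, v \in l ->
    0 < rg s rQh /\ (nth x0 q (rg s rQh).-1, v) \in arcs D;
  si_closed : forall i v, i < rg s rQh -> (nth x0 q i, v) \in arcs D ->
    v \in q \/ i.+1 = rg s rQh /\ v \in l;
  si_order : forall i, c0 < i < size q ->
    exists2 j, j < i & (nth x0 q j, nth x0 q i) \in arcs D;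
  si_c0 : 0 < size q -> c0 < size q /\ rg s rS = nth x0 q c0;
  si_c0closed : forall i v, i < c0 -> (nth x0 q i, v) \in arcs D ->
    v \in take c0 q;
  si_last : forall i v, seen q l (rg s rQh) i v ->
    exists j, [/\ seen q l (rg s rQh) j v, ar s 5 v = j.+1 & i <= j];
  si_pass :
    [/\ rg s rMark = 1, rg s rV <= n & forall v : 'I_n, v < rg s rV -> v \in q]
    \/ [/\ rg s rMark = 2, rg s rV = n, c0 = 0, 0 < size q
      & has_root D -> forall v, connect (arcrel D) (nth x0 q 0) v] }.

(** The first summand pays for the second search, at whose start [unpopped] is back at [m + n]. *)
Definition search_measure q (l : seq 'I_n) s :=
  (2 - rg s rMark) * (m + n + 2) + unpopped 1 (rg s rQh) q + size l
  + (n - rg s rV).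

Lemma search_inv_start s : build_inv al m s ->
  search_inv 0 [::] [::] (ex w build_code s).
Proof.
case=> h1 h2 h3 h4 h5 h6 h7 h8 h9 h10 h11 h12 h13 h14.
rewrite /= h8 h6 ltnn; split=> //=; rewrite /upd /= ?h9 ?h10 //.
- by move: h12; rewrite take_size.
- by move=> v; rewrite h13.
- by move=> v; rewrite h13.
- by move=> i; rewrite ltn0 andbF.
- by left.
Qed.

Lemma search_scan c0 q v l s : search_inv c0 q (v :: l) s ->
  exists q', search_inv c0 q' l (ex w (search_code k) s) /\
    search_measure q' l (ex w (search_code k) s) < search_measure q (v :: l) s.
Proof.
case=> h1 h2 h3 h4 h5 h6 h7 h8 h9 h10 h11 h12 h13 h14 h15 h16 h17 h18 h19 h20 h21.
case: h13 => /andP[e0 em] hd hc.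
have [qh0 uv] := h15 v (mem_head _ _).
have [vl ul] : v \notin l /\ uniq l by move: h14 => /= /andP[].
set h := rg s rQh in h8 h15 h16 h20 qh0 uv.
(* Only the LAST entry of [v] changes. It becomes [h], one plus the position of the tail, and no
   popped position is later. *)
have last' q' i (x : 'I_n) : (forall j, j < size q -> nth x0 q' j = nth x0 q j) ->
    seen q' l h i x ->
    exists j, [/\ seen q' l h j x, (if val x == val v then h else ar s 5 x) = j.+1 & i <= j].
  move=> hq' sx; have ih : i < h by case/andP: sx.
  have seenE j : x != v -> seen q' l h j x = seen q (v :: l) h j x.
    move=> xv; rewrite /seen; case: ltnP => //= jh; rewrite hq' ?(leq_trans jh) //.
    by rewrite inE (negbTE xv).
  case: eqP => [/val_inj xv|/eqP xv].
    subst x; exists h.-1; rewrite prednK //; split=> //; last by lia.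
    by rewrite /seen prednK // leqnn hq' ?uv ?(negbTE vl) ?andbF ?orbT //; lia.
  rewrite val_eqE in xv; rewrite seenE // in sx.
  have [j [j1 j2 j3]] := h20 _ _ sx; exists j; split=> //; by rewrite seenE.
rewrite /= /upd /upd2 /= ltnNge e0 /= hd -/h.
have := h11 v; case: ltnP => _ vq; rewrite /search_measure /=; last first.
  have {}vq : v \in q by rewrite -[_ \in _]negbK -vq.
  exists q; split; last by rewrite -/h; lia.
  split=> //=; rewrite -/h //.
  - by move=> x xl; apply: h15; rewrite inE xl orbT.
  - move=> i x ih ix; have [xq|[ihE]] := h16 i x ih ix; first by left.
    by rewrite inE => /orP[/eqP->|xl]; [left|right].
  - by move=> i x; apply: last'.
have {}vq : v \notin q by rewrite -vq.
have nthq j : j < size q -> nth x0 (rcons q v) j = nth x0 q j by move=> jq; rewrite nth_rcons jq.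
have q0 : 0 < size q by apply: leq_trans qh0 h8.
have hq : h.-1 < size q by rewrite prednK.
exists (rcons q v); split; last by rewrite -/h unpopped_rcons //; lia.
split=> //=; rewrite -/h ?size_rcons //.
- by rewrite h7.
- exact: leqW.
- move=> i; rewrite ltnS h7 nth_rcons; case: ltngtP => // iq _; exact: h9.
- by rewrite rcons_uniq vq.
- move=> x; rewrite mem_rcons inE negb_or -h11 val_eqE; case: eqP => _ //=; by rewrite ltnn.
- by move=> x; rewrite val_eqE; case: eqP.
- by move=> x xl; rewrite nthq //; apply: h15; rewrite inE xl orbT.
- move=> i x ih; rewrite nthq ?(leq_trans ih) // => ix; rewrite mem_rcons inE.
  have [->|[ihE]] := h16 i x ih ix; first by left; rewrite orbT.
  by rewrite inE => /orP[/eqP->|xl]; [left; rewrite eqxx|right].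
- move=> i /andP[ci]; rewrite ltnS leq_eqVlt => /orP[/eqP->|iq].
    exists h.-1 => //; by rewrite nthq // nth_rcons ltnn eqxx.
  have [|j ji jj] := h17 i; first by rewrite ci.
  by exists j => //; rewrite !nthq //; apply: ltn_trans iq.
- by have [c0q ->] := h18 q0; split; [apply: ltnW|rewrite nthq].
- have [c0q _] := h18 q0; move=> i x ic; rewrite nthq ?(ltn_trans ic) //.
  by rewrite -cats1 takel_cat ?(ltnW c0q) //; apply: h19.
- by move=> i x; apply: last'.
- case: h21 => [[p1 p2 p3]|[p1 p2 p3 p4 p5]]; [left|right]; split=> //.
    by move=> x xV; rewrite mem_rcons inE p3 ?orbT.
  by move=> hr x; rewrite nthq //; apply: p5.
Qed.

Lemma search_pop c0 q s : search_inv c0 q [::] s -> rg s rQh < size q ->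
  exists l, search_inv c0 q l (ex w (search_code k) s) /\
    search_measure q l (ex w (search_code k) s) < search_measure q [::] s.
Proof.
case=> h1 h2 h3 h4 h5 h6 h7 h8 h9 h10 h11 h12 h13 h14 h15 h16 h17 h18 h19 h20 h21 hq.
move: hq h8 h15 h16 h20; set h := rg s rQh => hq h8 h15 h16 h20.
rewrite /= /upd /upd2 /= h13 -/h h7 hq /= h9 //; set u := nth x0 q h.
exists (outl al u); split; last first.
  by rewrite /search_measure /= -/h (unpoppedS 1 h10 hq) -/u /=; lia.
split=> //=.
- exact: outl_uniq al_perm _.
- by move=> v; rewrite (mem_outl al_perm).
- move=> i v; rewrite ltnS leq_eqVlt => /orP[/eqP->|ih].
    by right; rewrite (mem_outl al_perm).
  by move=> iv; have [|[]] := h16 i v ih iv; [left|].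
move=> i v sv; case: eqP => [/val_inj->|/eqP vu].
  exists h; split=> //; last by case/andP: sv.
  by rewrite /seen ltnSn /= -/u eqxx.
rewrite val_eqE in vu.
have ih : i < h.
  move: sv; rewrite /seen ltnS => /andP[ih]; rewrite ltn_neqAle ih andbT.
  apply: contraTneq => ->; rewrite -/u eq_sym (negbTE vu) eqxx /= (mem_outl al_perm).
  by case: (_ \in _).
have sE j : j < h -> seen q (outl al u) h.+1 j v = seen q [::] h j v.
  by move=> jh; rewrite /seen jh ltnW //= andbF andbT eqSS (ltn_eqF jh) andbT.
rewrite sE // in sv; have [j [j1 j2 j3]] := h20 _ _ sv.
by exists j; split=> //; rewrite sE //; case/andP: j1.
Qed.

Lemma search_start c0 q s : search_inv c0 q [::] s -> rg s rQh = size q ->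
  rg s rMark = 1 -> rg s rV < n ->
  exists c0' q', search_inv c0' q' [::] (ex w (search_code k) s) /\
    search_measure q' [::] (ex w (search_code k) s) < search_measure q [::] s.
Proof.
case=> h1 h2 h3 h4 h5 h6 h7 h8 h9 h10 h11 h12 h13 h14 h15 h16 h17 h18 h19 h20 h21 hq hm vn.
case: h21 => [[_ _ p3]|[p1]]; last by rewrite p1 in hm.
pose v := Ordinal vn; have vE : rg s rV = v by [].
rewrite /= /upd /upd2 /= h13 h7 hq ltnn hm /= h4 vn.
have := h11 v; rewrite hm -vE; case: ltnP => _ vq /=; last first.
  have {}vq : v \in q by rewrite -[_ \in _]negbK -vq.
  exists c0, q; split; last by rewrite /search_measure /= hm; lia.
  split=> //=; left; split=> // x; rewrite ltnS leq_eqVlt => /orP[/eqP xv|]; last exact: p3.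
  by rewrite (_ : x = v) //; apply: val_inj.
have {}vq : v \notin q by rewrite -vq.
have nthq j : j < size q -> nth x0 (rcons q v) j = nth x0 q j by move=> jq; rewrite nth_rcons jq.
have cl i x : i < size q -> (nth x0 q i, x) \in arcs D -> x \in q.
  by move=> iq ix; have [||[]] := h16 i x _ ix; rewrite ?hq.
exists (size q), (rcons q v); split; last first.
  by rewrite /search_measure /= hm unpopped_rcons ?hq //; lia.
split=> //=; rewrite ?size_rcons ?hq ?h7 ?hm //.
- by move=> i; rewrite ltnS nth_rcons; case: ltngtP => // iq _; exact: h9.
- by rewrite rcons_uniq vq.
- move=> x; rewrite mem_rcons inE negb_or -h11 hm -[LHS]/((if x == v then _ else _) < 1).
  by case: eqP.
- by move=> x; case: ifP => // _; have := h12 x; rewrite hm.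
- by move=> i x ih; rewrite nthq // => /cl xq; left; rewrite mem_rcons inE xq ?orbT.
- by move=> i; rewrite ltnS; case: ltngtP.
- by split=> //; rewrite nth_rcons ltnn eqxx.
- move=> i x ih; rewrite nthq // => /cl xq.
  by rewrite -cats1 take_size_cat // xq.
- move=> i x; have sE j : seen (rcons q v) [::] (size q) j x = seen q [::] (size q) j x.
    by rewrite /seen; case: ltnP => //= jq; rewrite nthq.
  rewrite sE => sx; have := h20 i x; rewrite hq => /(_ sx)[j [j1 j2 j3]].
  by exists j; rewrite sE.
left; split=> // x; rewrite ltnS leq_eqVlt mem_rcons inE -val_eqE /= => /orP[->//|xV].
by rewrite p3 ?orbT.
Qed.

(** The queue before [c0] is closed under out-arcs, so a root there could not reach the vertex at
    [c0]. Every root was thus found by the last search and is reachable from its start. *)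
Lemma last_start_root c0 q l s : search_inv c0 q l s -> l = [::] ->
  rg s rQh = size q -> (forall v, v \in q) ->
  has_root D -> forall v, connect (arcrel D) (nth x0 q c0) v.
Proof.
move=> Hs l0 hq qall [r hr] v.
have uq := si_uniq Hs; have q0 : 0 < size q by case: q qall {Hs hq uq} => // /(_ x0).
have [c0q _] := si_c0 Hs q0; apply: connect_trans (hr v).
have rq : index r q < size q by rewrite index_mem.
case: (ltnP (index r q) c0) => rc; last first.
  rewrite -(nth_index x0 (qall r)).
  have [j] := ubnP (index r q); elim: j (index r q) rc rq => // j IH i ci iq ij.
  move: ci; rewrite leq_eqVlt => /orP[/eqP->|ci]; first exact: connect0.
  have [|a ai aa] := si_order Hs (i := i); first by rewrite ci.
  apply: connect_trans (connect1 aa); apply: IH; [|exact: ltn_trans iq|by lia].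
  (* The search parent is not before [c0] either, as arcs from there do not lead out. *)
  rewrite leqNgt; apply/negP => ac; have := si_c0closed Hs ac aa.
  by rewrite in_take // index_uniq //; lia.
have tc : forall x, connect (arcrel D) r x -> x \in take c0 q.
  move=> x /connectP[p]; have : r \in take c0 q by rewrite in_take.
  elim: p r {hr rq rc} => [|y p IH] z zt /=; first by move=> _ ->.
  case/andP=> zy; apply: IH; have zi : index z q < c0 by rewrite -in_take.
  by apply: (si_c0closed Hs zi); rewrite nth_index.
by have := tc _ (hr (nth x0 q c0)); rewrite in_take // index_uniq // ltnn.
Qed.

(** Raising the mark makes all vertices unvisited at once, without clearing VIS. Old LAST entries
    are overwritten when the second search pops their vertices. *)
Lemma search_restart c0 q s : search_inv c0 q [::] s -> rg s rQh = size q ->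
  rg s rMark = 1 -> n <= rg s rV ->
  exists q', search_inv 0 q' [::] (ex w (search_code k) s) /\
    search_measure q' [::] (ex w (search_code k) s) < search_measure q [::] s.
Proof.
move=> Hs; have lr := last_start_root Hs erefl; move: Hs.
case=> h1 h2 h3 h4 h5 h6 h7 h8 h9 h10 h11 h12 h13 h14 h15 h16 h17 h18 h19 h20 h21 hq hm vn.
case: h21 => [[_ p2 p3]|[p1]]; last by rewrite p1 in hm.
have qall v : v \in q by apply: p3; apply: leq_trans vn.
have {}lr := lr hq qall.
have q0 : 0 < size q by case: q qall {h7 h8 h9 h10 h11 h15 h16 h17 h18 h19 h20 hq p3 lr} => // /(_ x0).
have [c0q sE] := h18 q0; set u := nth x0 q c0 in sE lr.
rewrite /= /upd /upd2 /= h13 h7 hq ltnn hm /= h4 ltnNge vn /= sE.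
exists [:: u]; split; last first.
  by rewrite /search_measure /= hm unpopped0 ?hq //; lia.
split=> //=; rewrite ?size_rcons ?hq ?h7 ?hm //.
- by case.
- by move=> x; rewrite inE val_eqE; case: eqP => //= _; rewrite ltnS; have := h12 x; rewrite hm.
- by move=> x; rewrite val_eqE; case: eqP => // _; have := h12 x; rewrite hm; lia.
- by case=> // i; rewrite ltnS ltn0 andbF.
by right; split=> //; apply/eqP; rewrite eqn_leq p2.
Qed.

Record sweep_static (q : seq 'I_n) s : Prop := SweepStatic {
  ss_halt : rg s rHalt = 0;
  ss_ans : rg s rAns = 0;
  ss_n : rg s rN = n;
  ss_adj : adjacency (ar s) al;
  ss_size : size q = n;
  ss_uniq : uniq q;
  ss_all : forall v, v \in q;
  ss_q : forall i, i < n -> ar s 4 i = nth x0 q i;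
  ss_order : search_order D x0 q;
  ss_last_max : forall i v, i < n -> touches D x0 q i v -> i < ar s 5 v;
  ss_last : forall v : 'I_n,
    exists j, [/\ j < n, touches D x0 q j v & ar s 5 v = j.+1] }.

Definition sweep_start s := [/\ exists q, sweep_static q s, rg s rMode = 3,
  rg s rQh = 0, rg s rX = code (sweep_state0 k) & forall j, ar s 6 j = 0].

Lemma search_end q s : search_inv 0 q [::] s -> rg s rQh = size q ->
  rg s rMark = 2 -> let s' := ex w (search_code k) s in
  [/\ rg s' rHalt = 1, rg s' rAns = 0 & ~ has_root D] \/
  (has_root D /\ sweep_start s').
Proof.
case=> h1 h2 h3 h4 h5 h6 h7 h8 h9 h10 h11 h12 h13 h14 h15 h16 h17 h18 h19 h20 h21 hq hm.
case: h21 => [[p1]|[_ p2 _ p4 p5]]; first by rewrite p1 in hm.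
rewrite /= /upd /upd2 /= h13 h7 hq ltnn hm /= h4.
case: ltnP => qn /=.
  (* The queue is closed under out-arcs and, if there is a root, starts at one; it would contain all
     vertices. *)
  left; split=> // hr; move: qn; rewrite ltnNge => /negP; apply.
  rewrite -[n in n <= _]card_ord -(card_uniqP h10); apply: subset_leq_card.
  apply/subsetP => v _; have /connectP[p] := p5 hr v.
  elim: p (nth x0 q 0) (mem_nth x0 p4) => [|y p IH] z zq /=; first by move=> _ ->.
  case/andP=> zy; apply: IH; have zi : index z q < rg s 11 by rewrite hq index_mem.
  have zy' : (nth x0 q (index z q), y) \in arcs D by rewrite nth_index.
  by have [|[]] := h16 _ _ zi zy'.
have sq : size q = n.
  by apply/eqP; rewrite eqn_leq qn andbT -(card_uniqP h10) -[n in _ <= n]card_ord max_card.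
have qall v : v \in q.
  have /subset_cardP : #|q| = #|'I_n| by rewrite (card_uniqP h10) card_ord.
  by move=> /(_ (subset_predT _))/(_ v) ->.
right; split.
  exists (nth x0 q 0) => v; rewrite -(nth_index x0 (qall v)).
  have : index v q < size q by rewrite index_mem.
  have [j] := ubnP (index v q); elim: j (index v q) => // j IH [|i] ij iq; first exact: connect0.
  have [//|a ai aa] := h17 i.+1.
  by apply: connect_trans (connect1 aa); apply: IH; lia.
split=> //; exists q; split=> //=.
- by move=> i iq; apply: h9; rewrite sq.
- move=> i v iq tv; have sv : seen q [::] (rg s 11) i v.
    by rewrite /seen hq sq iq /=; case/orP: tv => ->; rewrite ?andbF ?orbT.
  by have [j [_ -> ij]] := h20 _ _ sv.
- move=> v; have sv : seen q [::] (rg s 11) (index v q) v.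
    by rewrite /seen hq index_mem qall nth_index // eqxx.
  have [j [sj lj _]] := h20 _ _ sv; exists j; move: sj; rewrite /seen hq sq => /andP[-> h]; split=> //.
  by case/orP: h => [h|/andP[h _]]; rewrite /touches h ?orbT.
Qed.

Lemma search_step c0 q l s : search_inv c0 q l s ->
  let s' := ex w (search_code k) s in
  [\/ [/\ rg s' rHalt = 1, rg s' rAns = 0 & ~ has_root D],
      has_root D /\ sweep_start s'
    | exists c0' q' l', search_inv c0' q' l' s' /\
        search_measure q' l' s' < search_measure q l s].
Proof.
move=> Hs s'; case: l Hs => [|v l] Hs; last first.
  by have [q' H] := search_scan Hs; constructor 3; exists c0, q', l.
case: (ltnP (rg s rQh) (size q)) => hq.
  by have [l' H] := search_pop Hs hq; constructor 3; exists c0, q, l'.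
have {}hq : rg s rQh = size q by apply/eqP; rewrite eqn_leq (si_qh Hs).
have [[hm _ _]|[hm _ c00 _ _]] := si_pass Hs.
  case: (ltnP (rg s rV) n) => vn.
    by have [c0' [q' H]] := search_start Hs hq hm vn; constructor 3; exists c0', q', [::].
  by have [q' H] := search_restart Hs hq hm vn; constructor 3; exists 0, q', [::].
rewrite c00 in Hs; have [H|H] := search_end Hs hq hm; by [constructor 1|constructor 2].
Qed.
End Search.

(** * The sweep phase *)

Section Sweep.
Variables (k n : nat) (D : digraph 'I_n) (al : seq ('I_n * 'I_n)).
Hypothesis al_perm : perm_eq al (enum (arcs D)).
Variables (x0 : 'I_n) (w : nat -> nat) (q : seq 'I_n).
Let m := size al.
Implicit Types (sl : 'I_n -> option 'I_(K k)) (N : {set 'I_n}).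
Implicit Types (P : {set 'I_n * 'I_n}) (s : state).

Definition used sl : {set 'I_(K k)} := [set a | [exists v, sl v == Some a]].

Lemma used_new sl v a : sl v = None -> used (upds sl v (Some a)) = a |: used sl.
Proof.
move=> v0; apply/setP => b; rewrite !inE; apply/existsP/orP => [[u]|].
  rewrite /upds; case: (u =P v) => [_ /eqP[->]|_ h]; first by left.
  by right; apply/existsP; exists u.
case=> [/eqP->|/existsP[u /eqP ub]]; first by exists v; rewrite /upds eqxx.
by exists u; rewrite /upds; case: (u =P v) => [uv|_]; [rewrite uv v0 in ub|rewrite ub].
Qed.

Lemma used_forget N P sl v a : slots_wf N P sl -> sl v = Some a ->
  used (upds sl v None) = used sl :\ a.
Proof.
move=> wf va; apply/setP => b; rewrite !inE; apply/existsP/andP => [[u]|].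
  rewrite /upds; case: (u =P v) => // uv /eqP ub; split.
    by apply/eqP => ba; case: uv; apply: (wf_inj wf) ub _; rewrite ba.
  by apply/existsP; exists u; rewrite ub.
case=> ba /existsP[u /eqP ub]; exists u; rewrite /upds ub; case: (u =P v) => // uv.
by move: ba; rewrite uv va in ub; case: ub => ->; rewrite eqxx.
Qed.

(** Registers 14 and 17 are [rX] and [rT], and array 6 is SLOT. *)
Definition frame s s' := (forall z, z \notin [:: 14; 17] -> rg s' z = rg s z) /\
  (forall a i, a != 6 -> ar s' a i = ar s a i).

Lemma sweep_static_frame s s' :
  (forall z, z \in [:: 0; 1; 3] -> rg s' z = rg s z) ->
  (forall a i, a != 6 -> ar s' a i = ar s a i) ->
  sweep_static D al x0 q s -> sweep_static D al x0 q s'.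
Proof.
move=> fr fa [h1 h2 h3 h4 h5 h6 h7 h8 h9 h10 h11]; split=> //; rewrite ?fr //.
- by move=> u; rewrite fa //; apply: chain_ext (h4 u) => // i _; rewrite fa.
- by move=> i hi; rewrite fa // h8.
- by move=> i v hi ti; rewrite fa //; apply: h10.
- by move=> v; have [j] := h11 v; exists j; rewrite fa.
Qed.

Record sweep_core P N sl s : Prop := SweepCore {
  sc_static : sweep_static D al x0 q s;
  sc_wf : slots_wf N P sl;
  sc_slot : forall v : 'I_n, ar s 6 v = if sl v is Some a then a.+1 else 0;
  sc_x : rg s rX = code (auto_sem k N P sl, used sl) }.

Lemma sweep_core_frame P N sl s s' :
  (forall z, z \in [:: 0; 1; 3; 14] -> rg s' z = rg s z) -> ar s' = ar s ->
  sweep_core P N sl s -> sweep_core P N sl s'.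
Proof.
move=> fr fa [h1 h2 h3 h4]; split=> //; rewrite ?fa ?fr //.
apply: sweep_static_frame h1 => [z hz|a i _]; last by rewrite fa.
by rewrite fr //; move: hz; rewrite !inE => /or3P[] ->; rewrite ?orbT.
Qed.

Lemma sweep_core_discard P N sl s v a x r : x \in [:: 7; 8] -> r \in [:: 15; 16] ->
  sweep_core P N sl s -> sl v = Some a -> rg s x = v -> rg s r = a.+1 ->
  let s' := ex w (discard_code k x r) s in
  sweep_core P N (if rg s rQh < ar s 5 v then sl else upds sl v None) s' /\
  frame s s'.
Proof.
move=> hx hr [h1 h2 h3 h4] va xv ra; cbv zeta.
set s1 := State (upd (rg s) 17 (ar s 5 v)) (ar s).
have -> : ex w (discard_code k x r) s = if rg s rQh < ar s 5 v then s1 else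
    State (upd (upd (rg s1) 14 (code (auto_forget a (auto_sem k N P sl), used sl :\ a))) 17 0) (upd2 (ar s) 6 v 0).
  rewrite /discard_code /= xv /upd /=; case: ifP => // _.
  rewrite (@ex_forget k w _ (auto_sem k N P sl, used sl) r a) //=; last first.
    by move: hr; rewrite !inE => /orP[] /eqP rE; subst r.
  by move: hx; rewrite !inE => /orP[] /eqP xE; subst x; rewrite /upd /= xv.
case: ltnP => _; split.
- split=> //; apply: sweep_static_frame h1 => [z|//].
  by rewrite !inE => /or3P[]/eqP->.
- by split=> // z; rewrite !inE negb_or /s1 /= /upd => /andP[_ /negbTE->].
- split=> //=.
  + apply: sweep_static_frame h1 => [z|b i /negbTE] /=.
      by rewrite !inE => /or3P[]/eqP->.
    by rewrite /upd2 => ->.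
  + case: h2 => w1 w2 w3; split=> //.
      by move=> u b; rewrite /upds; case: eqP => // _; apply: w1.
    move=> u u' b; rewrite /upds; case: eqP => // _; case: eqP => // _; exact: w3.
  + by move=> u; rewrite /upd2 /upds /= val_eqE h3; case: eqP.
  + by rewrite (auto_sem_forget k h2 va) (used_forget h2 va).
split=> [z|b i] /=; last by rewrite /upd2 => /negbTE->.
by rewrite !inE negb_or /upd => /andP[/negbTE-> /negbTE->].
Qed.

Lemma sweep_core_alloc P N sl s v x : x \in [:: 7; 8] ->
  sweep_core P N sl s -> v \notin N -> rg s x = v ->
  let s' := ex w (alloc_code k x) s in
  [/\ rg s' rHalt = 1, rg s' rAns = 1 & forall a, a \in used sl] \/
  exists2 a, sweep_core P (v |: N) (upds sl v (Some a)) s' & frame s s'.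
Proof.
move=> hx [h1 h2 h3 h4] vN xv; cbv zeta.
have v0 : sl v = None by case E: (sl v) => [a|] //; rewrite (wf_slot h2 E) in vN.
rewrite /alloc_code /= (ex_free w h4) /= /sweep_free /=; rewrite {1}/upd /=.
case: pickP => [a au|full] /=; last first.
  rewrite ltnn; left; split=> // a; have := full a; by move/negbFE.
rewrite ltn_ord; right; exists a.
all: rewrite (@ex_new k w _ (auto_sem k N P sl, used sl) a) //=.
  have xE : upd (upd (upd (rg s) 17 a) 14 (code (auto_new a (auto_sem k N P sl), a |: used sl))) 17 a.+1 x = v.
    by move: hx; rewrite !inE => /orP[] /eqP e; subst x; rewrite /upd /= xv.
  rewrite /upd /= in xE *; rewrite xE.
  have fa u : sl u <> Some a by move=> ua; case/negP: au; rewrite inE; apply/existsP; exists u; rewrite ua.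
  split=> //=.
  + apply: sweep_static_frame h1 => [z|b i /negbTE] /=.
      by rewrite !inE => /or3P[]/eqP->.
    by rewrite /upd2 => ->.
  + case: h2 => w1 w2 w3; split.
    * move=> u b; rewrite /upds in_setU1; case: (u =P v) => //= _; exact: w1.
    * by move=> u u' /w2[h h']; rewrite !in_setU1 h h' !orbT.
    * move=> u u' b; rewrite /upds; case: (u =P v) => [->|uv]; case: (u' =P v) => [->|uv'] //.
      - by case=> <- /fa.
      - by move=> ub [ab]; rewrite -ab in ub; case: (fa _ ub).
      - exact: w3.
  + by move=> u; rewrite /upd2 /upds /= val_eqE h3; case: eqP.
  + by rewrite (auto_sem_new k h2 vN fa) used_new.
split=> [z|b i] /=; last by rewrite /upd2 => /negbTE->.
by rewrite !inE negb_or /upd => /andP[/negbTE-> /negbTE->].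
Qed.

Lemma sweep_core_arc P N sl s u v a b :
  sweep_core P N sl s -> sl u = Some a -> sl v = Some b ->
  rg s rA = a.+1 -> rg s rB = b.+1 ->
  let s' := ex w (arc_code k) s in
  [/\ sweep_core ((u, v) |: P) N sl s', frame s s' & ar s' = ar s].
Proof.
move=> [h1 h2 h3 h4] ua vb ra rb; rewrite (ex_arc w h4 ra rb) /=; split=> //.
  split=> //=.
  + apply: sweep_static_frame h1 => [z|//] /=.
    by rewrite !inE => /or3P[]/eqP->.
  + case: h2 => w1 w2 w3; split=> // y z; rewrite in_setU1 => /orP[/eqP[-> ->]|]; last exact: w2.
    by split; [apply: w1 ua|apply: w1 vb].
  + by rewrite (auto_sem_arc k h2 ua vb).
by split=> // z; rewrite /= !inE negb_or /upd => /andP[/negbTE->].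
Qed.

Definition processed (l : seq 'I_n) h := [set x in arcs D |
  (index x.1 q < h) && ~~ (((index x.1 q).+1 == h) && (x.2 \in l))].

(** [last == h] means that the vertex popped last is the last to touch [v]. During its scan it keeps
    its own slot to the end, and a head keeps its slot until its arc has been read. *)
Definition expired (b : bool) (l : seq 'I_n) h last v :=
  (last < h) || (last == h) && (b ==> (v != nth x0 q h.-1) && (v \notin l)).

(* b tells whether the arcs leaving the vertex popped last are being scanned;
   l lists the heads of those that remain. *)
Record sweep_inv (b : bool) l N sl s : Prop := SweepInv {
  sw_core : sweep_core (processed l (rg s rQh)) N sl s;
  sw_mode : rg s rMode = 3 + b;
  sw_qh : rg s rQh <= n;
  sw_l : if b then chain (ar s 0) (ar s 1) m (rg s rE) l else l = [::];
  sw_luniq : uniq l;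
  sw_larc : forall v, v \in l -> (nth x0 q (rg s rQh).-1, v) \in arcs D;
  sw_cur : b -> [/\ 0 < rg s rQh, rg s rU = nth x0 q (rg s rQh).-1
    & exists2 a, sl (nth x0 q (rg s rQh).-1) = Some a & rg s rA = a.+1];
  sw_popped : forall i, i < rg s rQh -> nth x0 q i \in N;
  sw_touched : forall v, v \in N ->
    exists2 i, i < rg s rQh + ~~ b & touches D x0 q i v;
  sw_expired : forall v, v \in N ->
    (sl v == None) = expired b l (rg s rQh) (ar s 5 v) v }.

(** [n - #|N|] pays for the passes that allocate, as every vertex enters [N] once; [b] pays for the
    pass that ends a scan. *)
Definition sweep_measure (b : bool) (l : seq 'I_n) N s :=
  unpopped al 3 (rg s rQh) q + size l + (n - #|N|) + b.

Definition sweep_done s := rg s rHalt = 1 /\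
  (rg s rAns != 0 <-> k = 1 \/ leafy k D).

Definition sweep_next s mu := sweep_done s \/ exists b l N sl,
  sweep_inv b l N sl s /\ sweep_measure b l N s < mu.

Lemma sweep_overflow b l N sl s : sweep_inv b l N sl s ->
  (forall a, a \in used sl) -> k <= ell D.
Proof.
move=> [[st wf _ _] _ hn _ _ _ cur _ tch expd] full.
rewrite leqNgt; apply/negP => lk; pose Act := [set v | sl v != None].
have KA : K k <= #|Act|.
  rewrite -[K k]card_ord -cardsT.
  apply: leq_trans (leq_imset_card (fun v => odflt ord0 (sl v)) Act).
  apply: subset_leq_card; apply/subsetP => a _; have := full a.
  rewrite inE => /existsP[v /eqP va]; apply/imsetP; exists v; by rewrite ?inE va.
suff : #|Act| <= (ell D * ell D + ell D).+1.
  move=> AE; have := leq_trans KA AE; rewrite /K leqNgt => /negP; apply.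
  by rewrite !ltnS leq_add ?leq_mul // ltnW.
(* The position being handled: the next to be popped or, if [b] holds, the one whose arcs are being
   scanned. *)
apply: (@card_active _ D x0 q (ss_uniq st) (ss_all st) (ss_order st) Act (rg s rQh - b)).
move=> v; rewrite inE => vs.
have vN : v \in N by case E: (sl v) vs => [a|] // _; apply: (wf_slot wf) E.
have b0 : b <= rg s rQh by case: b cur {tch expd} => // /(_ isT)[].
have := expd v vN; rewrite (negbTE vs) => /esym/negbT nx.
split.
  have [i ib ti] := tch v vN; exists i => //; case: b ib b0 {cur tch expd nx} => /=; lia.
have [j [jn tj lj]] := ss_last st v; exists j => //; rewrite (ss_size st) jn andbT.
move: nx; rewrite lj /expired; case: b b0 {cur tch expd} => /=; lia.
Qed.

Hypothesis k_gt0 : 0 < k.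

Lemma sweep_full b l N sl s s' : sweep_inv b l N sl s ->
  (forall a, a \in used sl) -> rg s' rHalt = 1 -> rg s' rAns = 1 -> sweep_done s'.
Proof.
move=> Hs full h1 h2; split=> //; rewrite h2; split=> // _.
have kD := sweep_overflow Hs full.
by case: (ltnP 1 k) => k1; [right; apply/leafyP|left; lia].
Qed.

Lemma sweep_inv_regs (b : bool) l N sl s s' : ar s' = ar s ->
  (forall z, z \in [:: 0; 1; 2; 3; 11; 14] -> rg s' z = rg s z) ->
  (b -> forall z, z \in [:: 6; 7; 15] -> rg s' z = rg s z) ->
  sweep_inv b l N sl s -> sweep_inv b l N sl s'.
Proof.
move=> fa fr fb [h1 h2 h3 h4 h5 h6 h7 h8 h9 h10]; split; rewrite ?fa ?(fr 2) ?(fr 11) //.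
- apply: sweep_core_frame h1 => // z hz; apply: fr; move: hz.
  by rewrite !inE => /or4P[] ->; rewrite ?orbT.
- by case: b fb h4 {h2 h7 h9 h10} => // fb h4; rewrite fb.
- by move=> hb; have := h7 hb; rewrite !fb.
Qed.

Lemma sweep_alloc b l N sl s v x i : sweep_inv b l N sl s -> x \in [:: 7; 8] ->
  v \notin N -> rg s x = v -> i < rg s rQh + ~~ b -> touches D x0 q i v ->
  ~~ expired b l (rg s rQh) (ar s 5 v) v ->
  sweep_next (ex w (alloc_code k x) s) (sweep_measure b l N s).
Proof.
move=> Hs hx vN xv ib tv nx.
have [[e1 e2 full]|[a Hc [fr fa]]] := sweep_core_alloc hx (sw_core Hs) vN xv.
  by left; apply: sweep_full Hs full e1 e2.
right; set s' := ex _ _ _ in Hc fr fa *; exists b, l, (v |: N), (upds sl v (Some a)); split; last first.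
  rewrite /sweep_measure fr // cardsU1 vN add1n.
  have : #|v |: N| <= n by rewrite -[n in _ <= n]card_ord max_card.
  by rewrite cardsU1 vN; lia.
case: Hs => h1 h2 h3 h4 h5 h6 h7 h8 h9 h10.
split; rewrite ?fr //.
- case: b h4 {h2 h7 h9 h10 ib nx} => // h4.
  by apply: chain_ext h4 => // j _; rewrite fa.
- move=> hb; have [g1 g2 [c g3 g4]] := h7 hb; split=> //; exists c => //.
  rewrite /upds; case: eqP => // e; case/negP: vN; rewrite -e.
  by apply: h8; lia.
- by move=> j /h8; rewrite in_setU1 => ->; rewrite orbT.
- move=> u; rewrite in_setU1 => /orP[/eqP->|/h9//]; by exists i.
- move=> u; rewrite in_setU1 /upds fa //; case: (u =P v) => [-> _|_ /= uN].
    by rewrite (negbTE nx).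
  exact: h10.
Qed.

Lemma processed_pop h : h < n -> size q = n -> uniq q -> (forall v, v \in q) ->
  processed (outl al (nth x0 q h)) h.+1 = processed [::] h.
Proof.
move=> hn sq uq qall; apply/setP => -[u v]; rewrite !inE /= andbF andbT eqSS.
case uv: (_ \in _) => //=; rewrite ltnS.
case: ltngtP => //= hu; rewrite -hu nth_index // (mem_outl al_perm) uv //.
Qed.

Lemma sweep_pop_step l N sl s : sweep_inv false l N sl s ->
  sweep_next (ex w (pop_code k) s) (sweep_measure false l N s).
Proof.
move=> Hs; have st := sc_static (sw_core Hs); have wf := sc_wf (sw_core Hs).
have l0 : l = [::] by have := sw_l Hs.
have sq := ss_size st; have uq := ss_uniq st; have qall := ss_all st.
subst l; set h := rg s rQh.
have hn : h <= n := sw_qh Hs.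
rewrite /= -/h (ss_n st).
case: ltnP => hlt.
  set u := nth x0 q h.
  have uE : ar s 4 h = u by apply: ss_q st _ hlt.
  have tu : touches D x0 q h u by rewrite /touches eqxx.
  have lu := ss_last_max st hlt tu.
  rewrite {1}/upd /= {1}/upd /= uE.
  set s1 := State (upd (upd (rg s) 7 u) 15 (ar s 6 u)) (ar s).
  rewrite (sc_slot (sw_core Hs)); case E: (sl u) => [a|] /=.
    right; exists true, (outl al u), N, sl; split; last first.
      rewrite /sweep_measure /= /upd /= -/h (@unpoppedS _ al x0 3 h q) ?sq // -/u; lia.
    case: (sw_core Hs) => g1 g2 g3 g4.
    split; rewrite /= /upd /= -/h //.
    + rewrite processed_pop //; split=> //.
      by apply: sweep_static_frame g1 => [z|//]; rewrite !inE => /or3P[]/eqP->.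
    + exact: (ss_adj st).
    + exact: (outl_uniq al_perm).
    + by move=> v; rewrite -/u (mem_outl al_perm).
    + by move=> _; split=> //; exists a; rewrite -/u ?E.
    + move=> i; rewrite ltnS leq_eqVlt => /orP[/eqP->|]; last exact: (sw_popped Hs).
      exact: (wf_slot wf E).
    + move=> v /(sw_touched Hs)[i]; rewrite addn1 -/h => ih ti; exists i => //; by rewrite addn0.
    + move=> v vN; rewrite (sw_expired Hs vN) /expired -/h /= -/u.
      have [j [jn tj ->]] := ss_last st v; rewrite (mem_outl al_perm).
      (* What position [h] touches is [u] or a head in its list, so popping [u] makes nothing expire
         at [h]. *)
      have : j = h -> (v != u) && ((u, v) \notin arcs D) = false.
        by move=> jh; move: tj; rewrite jh /touches -/u eq_sym; case: eqP => //= _ ->.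
      by case: (_ && (_ \notin _)); lia.
  (* A vertex seen but without a slot has expired, whereas [u] touches itself at the position [h]
     still to be popped. *)
  have uN : u \notin N.
    apply/negP => uN; have := sw_expired Hs uN.
    by rewrite E /expired eqxx -/h; lia.
  have Hs1 : sweep_inv false [::] N sl s1.
    apply: sweep_inv_regs Hs => // z; rewrite !inE /s1 /= /upd.
    by do 5?[case/orP=> [/eqP->//|]] => /eqP->.
  have := sweep_alloc (s := s1) (v := u) (x := 7) (i := h) Hs1.
  apply=> //; rewrite /= ?/upd /= -/h ?addn1 //.
  by rewrite /expired; lia.
have hE : h = n by apply/eqP; rewrite eqn_leq hn.
left; rewrite /= (ex_accept w (sc_x (sw_core Hs))) /=; split=> //; rewrite /upd /= eqb0 negbK /sweep_accept /=.
have ltx v : index v q < n by have := qall v; rewrite -index_mem sq.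
(* With all positions popped, every vertex has been seen, every arc read and every slot freed, as
   [auto_sem_accept] requires. *)
have NT : N = [set: 'I_n].
  apply/setP => v; rewrite inE -(nth_index x0 (qall v)); apply: (sw_popped Hs).
  by rewrite -/h hE.
have PD : processed [::] (rg s 11) = arcs D.
  apply/setP => -[u v]; by rewrite !inE /= -/h hE ltx andbF andbT.
have sl0 v : sl v = None.
  have := sw_expired Hs (v := v); rewrite NT inE => /(_ isT).
  have [j [jn _ ->]] := ss_last st v; rewrite /expired -/h hE andbT.
  by case: (sl v) => // a /esym/negbT; lia.
rewrite NT PD; have acc := auto_sem_accept k D sl0.
split=> [/orP[/eqP|/acc]|[/eqP e|/acc e]]; [by left|by right|by rewrite e|by rewrite e orbT].
Qed.

Lemma processed_scan u v l h : 0 < h <= n -> size q = n -> uniq q ->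
  (forall x, x \in q) -> u = nth x0 q h.-1 -> (u, v) \in arcs D -> v \notin l ->
  processed l h = (u, v) |: processed (v :: l) h.
Proof.
move=> /andP[h0 hn] sq uq qall uE uv vl; have hq : h.-1 < size q by rewrite sq; lia.
have ui : index u q = h.-1 by rewrite uE index_uniq.
apply/setP => -[x y]; rewrite in_setU1 !inE /= xpair_eqE.
case: (x =P u) => [->|xu] /=.
  rewrite ui; case: (y =P v) => [->|_] //=.
  by rewrite uv prednK // leqnn eqxx (negbTE vl).
have -> : ((index x q).+1 == h) = false.
  by apply/eqP => e; case: xu; rewrite uE -e /= nth_index.
by [].
Qed.

Lemma sweep_scan_step l N sl s : sweep_inv true l N sl s ->
  sweep_next (ex w (scan_code k) s) (sweep_measure true l N s).
Proof.
move=> Hs; have Hc := sw_core Hs; have st := sc_static Hc; have wf := sc_wf Hc.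
have sq := ss_size st; have uq := ss_uniq st; have qall := ss_all st.
have [h0 uE [a ua ra]] := sw_cur Hs isT.
have hn := sw_qh Hs; have ch := sw_l Hs.
move: h0 uE ua; set h := rg s rQh in hn *; set u := nth x0 q h.-1 => h0 uE ua.
have tu v : (u, v) \in arcs D -> touches D x0 q h.-1 v by rewrite /touches -/u => ->; rewrite orbT.
have hh : h.-1 < n by lia.
have lu v : (u, v) \in arcs D -> h <= ar s 5 v.
  by move=> /tu tv; have := ss_last_max st hh tv; lia.
case: l Hs Hc wf ch => [|v l] Hs Hc wf ch.
  have e0 : rg s 6 = 0 by [].
  rewrite /= e0 /=.
  have [||Hc' [fr fa]] := @sweep_core_discard _ _ _ s u a 7 15 _ _ Hc ua uE ra => //.
  set s' := ex _ _ _ in Hc' fr fa *; rewrite -/h in Hc'.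
  right; exists false, [::], N, (if h < ar s 5 u then sl else upds sl u None); split; last first.
    by rewrite /sweep_measure /= /upd /= fr // -/h; lia.
  have hE : rg s' 11 = h by rewrite fr.
  split; rewrite /= /upd /= ?hE //.
  + by apply: sweep_core_frame Hc' => // z; rewrite !inE => /or4P[]/eqP->.
  + exact: (sw_popped Hs).
  + move=> x /(sw_touched Hs)[i]; rewrite addn0 -/h => ih ti; exists i => //; lia.
  + move=> x xN; have := sw_expired Hs xN; rewrite fa // /expired -/h -/u /= andbT.
    have lastu : h <= ar s 5 u.
      by have := ss_last_max st hh (v := u); rewrite /touches eqxx => /(_ isT); lia.
    case: (x =P u) => [->|xu] /=; last first.
      rewrite andbT => <-; case: ifP => // _; rewrite /upds; by case: (x =P u).
    move=> _; case: ltnP => lt; first by rewrite ua -[_ == None]/false; lia.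
    by rewrite /upds !eqxx; lia.
have [/andP[e0 em] hd hc] := ch.
have uv : (u, v) \in arcs D by apply: (sw_larc Hs); rewrite mem_head.
have [vl ul] : v \notin l /\ uniq l by have := sw_luniq Hs => /= /andP[].
rewrite /= ltnNge e0 /= {1}/upd /= {1}/upd /= hd.
set s1 := State (upd (upd (rg s) 8 v) 16 (ar s 6 v)) (ar s).
have Hs1 : sweep_inv true (v :: l) N sl s1.
  apply: sweep_inv_regs Hs => // [z|_ z]; rewrite !inE /s1 /= /upd.
    by do 5?[case/orP=> [/eqP->//|]] => /eqP->.
  by case/or3P => /eqP->.
rewrite (sc_slot Hc); case E: (sl v) => [b|] /=; last first.
  have nx : ~~ expired true (v :: l) h (ar s 5 v) v.
    by rewrite /expired mem_head /= !andbF orbF -leqNgt lu.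
  have vN : v \notin N.
    by apply/negP => vN; case/negP: nx; rewrite -(sw_expired Hs vN) E.
  have := sweep_alloc (s := s1) (v := v) (x := 8) (i := h.-1) Hs1.
  apply=> //; last exact: tu.
  by rewrite /= /upd /= -/h addn0; lia.
set s2 := State (upd (upd (upd (rg s) 8 v) 16 b.+1) 6 (ar s 1 (rg s 6))) (ar s).
suff H : sweep_next (ex w (discard_code k 8 16) (ex w (arc_code k) s2))
    (sweep_measure true (v :: l) N s) by exact: H.
have Hc2 : sweep_core (processed (v :: l) h) N sl s2.
  by apply: sweep_core_frame Hc => // z; rewrite !inE => /or4P[]/eqP->.
have [||Hc3 [fr3 fa3] ar3] := sweep_core_arc Hc2 ua E.
- by rewrite /s2 /= /upd /=.
- by [].
move: Hc3 fr3 fa3 ar3; set s3 := ex w (arc_code k) s2 => Hc3 fr3 fa3 ar3.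
have [||||Hc' [fr fa]] := @sweep_core_discard _ _ _ s3 v b 8 16 _ _ Hc3 E => //.
- by rewrite fr3.
- by rewrite fr3.
set s' := ex _ _ _ in Hc' fr fa *.
have h3 : rg s3 11 = h by rewrite fr3.
have hE : rg s' 11 = h by rewrite fr.
rewrite h3 ar3 in Hc'.
(* Discarding the head must not take away the slot of the tail, which is still being scanned. *)
have uv' : u != v by apply: contraTneq uv => ->; apply: loopless.
set sl' := if _ then _ else _ in Hc'.
have slE x : x != v -> sl' x = sl x.
  by move=> xv; rewrite /sl'; case: ifP => // _; rewrite /upds (negbTE xv).
have ar5 x : ar s' 5 x = ar s 5 x by rewrite fa // ar3.
right; exists true, l, N, sl'; split; last first.
  by rewrite /sweep_measure hE -/h /=; lia.
split; rewrite ?hE ?fr ?fr3 //.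
+ by rewrite (@processed_scan u v) // h0.
+ exact: (sw_mode Hs).
+ rewrite /s2 /= /upd /=; apply: chain_ext hc => // j _; by rewrite fa // ar3.
+ by move=> x xl; apply: (sw_larc Hs); rewrite inE xl orbT.
+ by move=> _; split=> //; exists a; rewrite // slE.
+ exact: (sw_popped Hs).
+ exact: (sw_touched Hs).
move=> x xN; rewrite ar5; have := sw_expired Hs xN; rewrite /expired -/h -/u /= inE.
have [->|xv] := eqVneq x v; last by rewrite slE.
move=> _; rewrite (negbTE vl) andbT [v == u]eq_sym uv' andbT /sl'.
have luv := lu v uv; case: (ltnP h (ar s 5 v)) => lt; first by rewrite E -[_ == None]/false; lia.
by rewrite /upds !eqxx; lia.
Qed.
End Sweep.

Lemma sweep_inv_start (k n : nat) (D : digraph 'I_n) (al : seq ('I_n * 'I_n))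
    (x0 : 'I_n) q s :
  sweep_static D al x0 q s -> rg s rMode = 3 -> rg s rQh = 0 ->
  rg s rX = code (sweep_state0 k) -> (forall j, ar s 6 j = 0) ->
  sweep_inv (k := k) D al x0 q false [::] set0 (fun=> None) s.
Proof.
move=> st hmode hqh hx hslot.
have P0 : processed D q [::] 0 = set0 by apply/setP => a; rewrite !inE ltn0 andbF.
have U0 : @used k n (fun=> None) = set0.
  by apply/setP => a; rewrite !inE; apply/existsP => -[].
have S0 : auto_sem k (V := 'I_n) set0 set0 (fun=> None : option 'I_(K k)) = (sweep_state0 k).1.
  (* Before any vertex is read, all labellings and all sets X look alike. *)
  have E lam (chi : {ffun 'I_n -> bool}) :
      check_sem k set0 set0 (fun=> None : option 'I_(K k)) lam chi = check_state0 k.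
    rewrite /check_sem /check_state0; congr (_, _, _, _, _).
    - by rewrite (_ : [set v in _ | _] = set0) ?cards0 ?min0n //; apply/setP => v; rewrite !inE.
    - by rewrite (_ : [set v in _ | _] = set0) ?cards0 ?min0n //; apply/setP => v; rewrite !inE.
    - by apply/negbTE; rewrite negb_or; apply/andP; split; apply/existsPn => a; rewrite inE.
    - by apply/existsP => -[v]; rewrite inE.
    - by apply/ffunP => a; rewrite !ffunE; case: pickP.
  apply/setP => S; rewrite inE; apply/imsetP/eqP => [[lam _ ->]|->].
    apply/setP => y; rewrite inE; apply/imsetP/eqP => [[chi _ ->]|->]; first exact: E.
    by exists [ffun=> false]; rewrite ?E.
  exists [ffun=> None] => //; apply/setP => y; rewrite inE.
  apply/eqP/imsetP => [->|[chi _ ->]]; last by rewrite E.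
  by exists [ffun=> false]; rewrite ?E.
split; rewrite ?hqh ?P0 //.
- split=> //; first by split=> // u v; rewrite inE.
  by rewrite hx S0 U0.
- by move=> v; rewrite inE.
- by move=> v; rewrite inE.
Qed.

(** * Termination after linearly many passes *)

Lemma loop_terminates (f : state -> state) (I : nat -> state -> Prop) (J : state -> Prop) :
  (forall mu s, I mu s ->
    rg s rHalt = 0 /\ (J (f s) \/ exists2 mu', mu' < mu & I mu' (f s))) ->
  forall mu s, I mu s -> exists t, [/\ 0 < t <= mu.+1, J (iter t f s)
    & forall i, i < t -> rg (iter i f s) rHalt = 0].
Proof.
move=> H mu; have [b] := ubnP mu; elim: b mu => // b IH mu hb s Is.
have [h0 [Js|[mu' lt Is']]] := H _ _ Is; first by exists 1; split=> // -[].
have [|t [tm Jt ht]] := IH mu' _ _ Is'; first by lia.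
exists t.+1; rewrite iterSr; split=> //; first by lia.
by case=> [|i] hi //; rewrite iterSr; apply: ht.
Qed.

Section Main.
Variables (k n : nat) (D : digraph 'I_n) (al : seq ('I_n * 'I_n)).
Hypothesis k_gt0 : 0 < k.
Hypothesis al_perm : perm_eq al (enum (arcs D)).
Hypothesis D_calL : calL D.
Let m := size al.
Let f := ex (nth 0 (encode al)) (body k).

Definition answered s := rg s rHalt = 1 /\ (rg s rAns != 0 <-> k <= ell_s D).

Lemma answered_no s : rg s rHalt = 1 -> rg s rAns = 0 -> ~ has_root D -> answered s.
Proof.
move=> h1 h2 nr; split=> //; rewrite h2; split=> // hk; case: nr.
by apply/has_rootP; apply: leq_trans hk.
Qed.

Lemma answered_sweep s : sweep_done k D s -> has_root D -> answered s.
Proof.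
move=> [h1 h2] hr; split=> //; rewrite h2 leq_ell_s //.
by split=> [h|[]].
Qed.

Lemma body_terminates : exists t, [/\ 0 < t <= 7 * (n + m).+1,
  answered (iter t f state0) & forall i, i < t -> rg (iter i f state0) rHalt = 0].
Proof.
have [n0|n0] := posnP n.
  exists 1; split=> //; last by case.
  have nr : ~ has_root D by case=> r _; have := ltn_ord r; lia.
  have n1 : n < 1 by rewrite n0.
  by apply: answered_no nr; rewrite /= /f ex_body /= /upd /= n1.
pose x0 : 'I_n := Ordinal n0.
(* The measures at the start of the sweep and of the search; the summands 2 and 1 in [I] pay for the
   changes of phase. *)
pose C3 := m + 4 * n; pose C2 := 2 * m + 3 * n + 2.
pose I mu s := [\/ exists2 i, build_inv al i s & mu = (m - i) + C2 + C3 + 2,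
  exists c0 q l, search_inv D al x0 c0 q l s /\ mu = search_measure al q l s + C3 + 1
  | has_root D /\ exists q b l N sl, sweep_inv (k := k) D al x0 q b l N sl s /\
     mu = sweep_measure al q b l N s].
have step mu s : I mu s ->
    rg s rHalt = 0 /\ (answered (f s) \/ exists2 mu', mu' < mu & I mu' (f s)).
  case=> [[i Hs ->]|[c0 [q [l [Hs ->]]]]|[hr [q [b [l [N [sl [Hs ->]]]]]]]].
  - split; first exact: bi_halt Hs.
    right; rewrite /f ex_body (bi_mode Hs).
    case: (ltnP i m) => im.
      exists ((m - i.+1) + C2 + C3 + 2); first by lia.
      by constructor 1; exists i.+1 => //; exact: (build_step n0 Hs im).
    have iE : i = m by apply/eqP; rewrite eqn_leq im (bi_le Hs).
    rewrite {i im}iE in Hs *; have Hs' := search_inv_start D x0 (nth 0 (encode al)) Hs.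
    exists (search_measure al [::] [::] (ex (nth 0 (encode al)) build_code s) + C3 + 1); last first.
      by constructor 2; exists 0, [::], [::].
    rewrite /search_measure /= (bi_e Hs) (bi_m Hs) ltnn /= /upd /= (bi_v Hs) (bi_qh Hs).
    by rewrite unpopped0 /C2 -/m; lia.
  - split; first exact: si_halt Hs.
    have := search_step k al_perm (nth 0 (encode al)) Hs.
    rewrite /f ex_body (si_mode Hs); cbv zeta; set s' := ex _ _ s.
    case=> [[h1 h2 nr]|[hr [[q' st] h1 h2 h3 h4]]|[c0' [q' [l' [Hs' lt]]]]].
    + by left; apply: answered_no.
    + right; exists C3; first by lia.
      constructor 3; split=> //; exists q', false, [::], set0, (fun=> None).
      split; first exact: sweep_inv_start.
      by rewrite /sweep_measure h2 unpopped0 cards0 /C3 -/m /=; lia.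
    right; exists (search_measure al q' l' s' + C3 + 1); first by lia.
    by constructor 2; exists c0', q', l'.
  split; first exact: ss_halt (sc_static (sw_core Hs)).
  have : sweep_next k D al x0 q (f s) (sweep_measure al q b l N s).
    rewrite /f ex_body (sw_mode Hs); case: b Hs => Hs /=.
      by apply: sweep_scan_step Hs.
    by apply: sweep_pop_step Hs.
  case=> [dn|[b' [l' [N' [sl' [Hs' lt]]]]]]; first by left; apply: answered_sweep.
  right; exists (sweep_measure al q b' l' N' (f s)) => //.
  by constructor 3; split=> //; exists q, b', l', N', sl'.
have I0 : I (m + C2 + C3 + 2) (f state0).
  constructor 1; exists 0; last by rewrite subn0.
  by rewrite /f ex_body; apply: build_init.
have [t [ht Jt lt]] := loop_terminates step I0.
exists t.+1; rewrite iterSr; split=> //; first by rewrite /C2 /C3 in ht; lia.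
by case=> [|i] hi //; rewrite iterSr; apply: lt.
Qed.
End Main.

Lemma answers_within_le P w T T' B B' b : T <= T' -> B <= B' ->
  answers_within P w T B b -> answers_within P w T' B' b.
Proof.
move=> hT hB [t [h1 h2 h3 h4]]; exists t; split=> //; first exact: leq_trans hT.
by move=> i hi; apply: word_bounded_le hB (h4 i hi).
Qed.

Theorem theorem4p5 (k : nat) (hk : 0 < k) :
  exists (P : program) (c : nat),
    forall (n : nat) (D : digraph 'I_n) (s : seq ('I_n * 'I_n)),
      perm_eq s (enum (arcs D)) ->
      calL D ->
      answers_within P (encode s)
        (c * (n + #|arcs D|).+1) (c * (n + #|arcs D|).+1 ^ c)
        (k <= ell_s D).
Proof.
have [c Hc] := loop_program_correct (body k).
(* With [S] as below, the input has words and length at most [2 * S], and [t <= 7 * S]; so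
   [2 * S + t.+1 <= 10 * S]. *)
exists (loop_program (body k)), (10 * c).+1 => n D s hs hD.
have [t [ht [h1 h2] h3]] := body_terminates hk hs hD.
have mE : #|arcs D| = size s by rewrite (perm_size hs) cardE.
rewrite mE; set S := (n + size s).+1 in ht *.
have -> : (k <= ell_s D) = (rg (iter t (ex (nth 0 (encode s)) (body k)) state0) 0 != 0).
  by apply/idP/idP => /h2.
apply: answers_within_le (Hc (encode s) t (2 * S) _ _ _ _ _ _).
- by nia.
- have le : S <= S ^ (10 * c).+1 by rewrite -{1}[S]expn1 leq_pexp2l.
  apply: (@leq_trans ((10 * c).+1 * S)); first by nia.
  by rewrite leq_mul2l le orbT.
- by rewrite size_encode.
- by move=> i; apply: leq_trans (encode_le _ _) _; rewrite /S; lia.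
- by rewrite size_encode /S; lia.
- by case/andP: ht.
- by move=> i /andP[_]; apply: h3.
- by rewrite h1.
Qed.
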